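(* There exist a Hausdorff topology $\tau'$ on $C(K)$, a $C^*$-subalgebra $Y_1$ of $C(K)$ and a Banach subspace $Y_2$ of $C(K)$ such that: 1) $\tau_p$ is finer than $\tau'$. 2) $(C(K),\tau')$ is not universally measurable. 3) $Y_1$ and $Y_2$ are $\tau_p$-closed and $(C(K),\tau_p)=(Y_1,\tau_p)\oplus(Y_2,\tau_p)$. 4) $(Y_1,\tau_p)$ is isomorphic to $(Y_2,\tau_p)$ (as topological vector spaces). 5) $(Y_j,\tau_p)=(Y_j,\tau')$ for $j\in\{1,2\}$, i.e. $\tau_p$ and $\tau'$ induce the same topology on $Y_j$. 6) $(Y_1,\tau_p)$ contains a closed discrete uncountable subset which is contained in $M$. 7) $\mathrm{Bor}(C(K),\tau')\otimes \mathrm{Bor}(C(K),\tau')\neq \mathrm{Bor}(C(K)\times C(K),\tau'\times\tau')$. 8) The projection $P:(C(K),\tau')\to (Y_1,\tau')$ (associated with the decomposition $C(K)=Y_1\oplus Y_2$) is not a Borel function. 9) The set $\{H:E\to (C(K),\tau')\,;\ H \text{ is a Borel function}\}$ is not a vector subspace of $C(K)^E$.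
   Context: Setting: $E$ is an uncountable abelian group with a total order $\le$ satisfying $a\le b\iff a-b\le 0$ for all $a,b\in E$; the order topology $\tau_0$ (generated by the sets $\{x<a\}$ and $\{x>b\}$, $a,b\in E$) is the group topology, and for it $E$ is locally compact, separable and connected. ($E$ has no greatest and no least element.) $\mu=m$ is the Haar measure of $E$. For $t\in E$ let $f^t$ be the characteristic function of $\{u\in E:u>t\}$, and let $A$ be the (norm-closed, unital) $C^*$-subalgebra of the complex space $L^\infty(E,\mu)$ generated by $\{f^t:t\in E\}$. $K=K_\mu(E)$ is the set of characters of $A$ with the weak$^*$ topology $\sigma(A^*,A)$; it is a compact Hausdorff space and $A$ is identified with $C(K)$ (complex continuous functions) via $g(\theta)=\theta(g)$, so $C(K)\subset L^\infty(E,\mu)$. $\tau_p$ denotes the topology of pointwise convergence on $K$. For $g\in C(K)\subset L^\infty(E,\mu)$, $\check g(x)=g(-x)$ for almost all $x\in E$ (then $\check g\in C(K)$); $g$ is even if $g=\check g$. $M$ is the set of even functions in $C(K)$ which, as functions on $K$, take values in $\{0,1,2\}$. $\mathrm{Bor}(X,\tau)$ is the Borel $\sigma$-algebra of a topological space $(X,\tau)$; $\otimes$ between $\sigma$-algebras is the product $\sigma$-algebra. A map is Borel if preimages of Borel sets are Borel; $E$ carries $\mathrm{Bor}(E,\tau_0)$. A completely regular Hausdorff space $X$ is universally measurable if it is $\lambda$-measurable in its Stone–Čech compactification $\beta X$ for every finite Radon measure $\lambda$ on $\beta X$; equivalently, every normal Borel probability measure $\nu$ on $X$ (i.e. $\nu(\bigcup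 O_\alpha)=\lim\nu(O_\alpha)$ for every increasing net of open sets) is a Radon measure. *)

(* Defs.v *)
From HB Require Import structures.
From mathcomp Require Import all_boot all_order all_algebra.
From mathcomp Require Import all_classical all_reals all_analysis.
From mathcomp Require Import complex.

Set Implicit Arguments.
Unset Strict Implicit.
Unset Printing Implicit Defensive.

Import Order.TTheory GRing.Theory Num.Theory.
Import numFieldNormedType.Exports.

Local Open Scope classical_set_scope.
Local Open Scope ring_scope.

(* The complex field, seen as an abstract numeric field so that it receives the
   topology of its norm. *)
Definition Cplx (R : realType) : numClosedFieldType := R[i].

Section general_topology.

Definition borel_sets (X : topologicalType) : set (set X) := <<s @open X >>.

Definition borel_fun (X Y : topologicalType) (f : X -> Y) :=
  forall B, borel_sets B -> borel_sets (f @^-1` B).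

Definition prod_sigma_algebra (X Y : Type) (S : set (set X)) (T : set (set Y)) :
  set (set (X * Y)) := <<s [set A `*` B | A in S & B in T] >>.

Definition homeomorphism (X Y : topologicalType) (f : X -> Y) :=
  continuous f /\ exists g : Y -> X, [/\ continuous g, cancel f g & cancel g f].

Definition subspace_type (X : topologicalType) (Y : set X) : topologicalType :=
  initial_topology (val : Y -> X).

Definition separable (X : topologicalType) :=
  exists2 D : set X, countable D & dense D.

(* A value of [Topological T] is a topology on [T]; the carrier of
   [with_topology tau] is convertible to [T]. *)
Definition with_topology (T : Type) (tau : Topological T) : topologicalType :=
  Topological.Pack tau.

Definition finer (T : Type) (tau sigma : Topological T) :=
  forall U : set T, @open (with_topology sigma) U -> @open (with_topology tau) U.

Definition same_on (T : Type) (tau sigma : Topological T) (Y : set T) :=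
  @open (@subspace_type (with_topology tau) Y) =
  @open (@subspace_type (with_topology sigma) Y).

End general_topology.

Section universal_measurability.
Variable R : realType.

(* Finite measures only: finiteness on compact sets is automatic. *)
Definition finite_radon (B : ptopologicalType)
    (lam : {finite_measure set (g_sigma_algebraType (@open B)) -> \bar R}) :=
  forall A, borel_sets (A : set B) ->
    lam A = ereal_sup [set lam C | C in
      [set C : set B | compact C /\ C `<=` A]].

Definition stone_cech (X : topologicalType) (B : ptopologicalType) (e : X -> B) :=
  [/\ compact [set: B], hausdorff_space B,
      homeomorphism (fun x : X =>
        SigSub (mem_set (imageT e x)) : @subspace_type B (range e)),
      dense (range e) &
      forall f : X -> R, continuous f -> (exists M, forall x, `|f x| <= M) ->
        exists2 g : B -> R, continuous g & g \o e = f].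

(* Completeness of [lam]: [A] is [lam]-measurable when it lies between two Borel
   sets that differ by a null set. *)
Definition radon_measurable (B : ptopologicalType)
    (lam : {finite_measure set (g_sigma_algebraType (@open B)) -> \bar R})
    (A : set B) :=
  exists A1 A2 : set B, [/\ borel_sets A1, borel_sets A2,
    A1 `<=` A, A `<=` A2 & lam (A2 `\` A1) = 0%E].

(* A Stone-Cech compactification is unique up to a homeomorphism fixing [X], and
   exists when [X] is completely regular and Hausdorff. For any other [X] there
   is none and the property holds vacuously, so its negation does entail that
   [X] is completely regular and Hausdorff. *)
Definition universally_measurable (X : topologicalType) :=
  forall (B : ptopologicalType) (e : X -> B), stone_cech e ->
  forall lam : {finite_measure set (g_sigma_algebraType (@open B)) -> \bar R},
    finite_radon lam -> radon_measurable lam (range e).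

End universal_measurability.

Section continuous_functions.
Variables (X : topologicalType) (K : numFieldType).

Definition cts : {pred X -> K} := mem [set f : X -> K | continuous f].

Definition cts_Sub (f : X -> K) (fP : f \in cts) : continuousType X K :=
  mkcts (set_mem fP).

Lemma cts_rect (P : continuousType X K -> Type) :
  (forall f (fP : f \in cts), P (cts_Sub fP)) -> forall g, P g.
Proof.
move=> Psub g.
have gP : (g : X -> K) \in cts by exact/mem_set/cts_fun.
by have -> : g = cts_Sub gP by exact/continuousEP.
Qed.

Lemma cts_valP f (fP : f \in cts) : cts_Sub fP = f :> (X -> K).
Proof. by []. Qed.

HB.instance Definition _ := isSub.Build _ _ (continuousType X K) cts_rect cts_valP.

Lemma cts_subring_closed : subring_closed cts.
Proof.
split=> [|f g|f g]; rewrite !inE /=.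
- by move=> x; exact: cvg_cst.
- by move=> cf cg x; apply: cvgB; [exact: cf|exact: cg].
- by move=> cf cg x; apply: cvgM; [exact: cf|exact: cg].
Qed.

Lemma cts_submod_closed : submod_closed (cts : {pred X -> K^o}).
Proof.
split=> [|a f g]; rewrite !inE /=; first by move=> x; exact: cvg_cst.
by move=> cf cg x; apply: cvgD; [apply: cvgZr; exact: cf|exact: cg].
Qed.

HB.instance Definition _ := GRing.SubChoice_isSubComPzRing.Build _ _
  (continuousType X K) cts_subring_closed.
HB.instance Definition _ := GRing.SubZmodule_isSubLmodule.Build K (X -> K^o) cts
  (continuousType X K) (GRing.submod_closed_semi cts_submod_closed).

End continuous_functions.

Section function_algebras.
Variables (K : topologicalType) (C : numClosedFieldType).
Local Notation CK := (continuousType K C).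

Definition tau_p : Topological CK :=
  Topological.class (initial_topology (fun g : CK => (g : {ptws K -> C}))).

Definition norm_closed (Y : set CK) :=
  forall g : CK, (forall e : C, 0 < e ->
    exists2 h, Y h & forall theta, `|g theta - h theta| <= e) -> Y g.

Definition banach_subspace (Y : set CK) := submod_closed (mem Y) /\ norm_closed Y.

Definition cstar_subalgebra (Y : set CK) :=
  [/\ banach_subspace Y,
      forall f g : CK, Y f -> Y g -> Y (f * g) &
      forall f g : CK, Y f -> (forall theta, g theta = (f theta)^*) -> Y g].

End function_algebras.

Section linear_decompositions.
Variables (C : numDomainType) (V : lmodType C) (tau : Topological V).
Local Notation sub Y := (@subspace_type (with_topology tau) Y).

Definition topological_direct_sum (Y1 Y2 : set V) :=
  homeomorphism (fun y : (sub Y1 * sub Y2)%type =>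
    (val y.1 + val y.2 : V) : with_topology tau).

(* Linearity is stated in [V] because the subspaces are bare sets. *)
Definition tvs_isomorphic (Y1 Y2 : set V) :=
  exists2 T : sub Y1 -> sub Y2, homeomorphism T &
    forall (a : C) (x y z : Y1), val z = a *: val x + val y :> V ->
      val (T z) = a *: val (T x) + val (T y) :> V.

End linear_decompositions.

Section ordered_group.
Variables (R : realType) (E : topologicalZmodType).
Variables (d : Order.disp_t) (ord : Order.Total d E).
Local Notation C := (Cplx R).

Definition with_order : orderType d := Order.Total.Pack ord.

Definition borel_type : measurableType _ :=
  g_sigma_algebraType (T := GRing.Zmodule.sort E) (@open E).

Definition haar_measure (mu : {measure set borel_type -> \bar R}) :=
  [/\ mu setT != 0%E,
      forall (a : E) (A : set E), borel_sets A -> mu [set a + x | x in A] = mu A,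
      forall A : set E, compact A -> (mu A < +oo)%E,
      forall A : set E, borel_sets A ->
        mu A = ereal_inf [set mu U | U in [set U : set E | open U /\ A `<=` U]] &
      forall U : set E, open U ->
        mu U = ereal_sup [set mu A | A in [set A : set E | compact A /\ A `<=` U]]].

Variable mu : {measure set borel_type -> \bar R}.

(* Elements of L^oo are represented by functions; identities between them are
   always required almost everywhere only. *)
Definition Linfty : set (E -> C) :=
  [set f | borel_fun f /\ exists M : C, {ae mu, forall x, `|f x| <= M}].

(* The last clause makes [B] norm closed and, as a consequence, a union of
   classes modulo almost everywhere equality. *)
Definition unital_cstar_subalgebra (B : set (E -> C)) :=
  [/\ B `<=` Linfty,
      B (cst 1) /\ submod_closed (mem B),
      forall f g, B f -> B g -> B (f * g),
      forall f, B f -> B (fun x => (f x)^* ) &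
      forall f, Linfty f ->
        (forall e : C, 0 < e ->
          exists2 g, B g & {ae mu, forall x, `|f x - g x| <= e}) -> B f].

Definition ray_indicator (t : E) : E -> C :=
  fun u => ((t : with_order) < u)%O%:R.

Definition ray_algebra : set (E -> C) :=
  [set f | forall B, unital_cstar_subalgebra B ->
    (forall t, B (ray_indicator t)) -> B f].

(* Each identity being assumed almost everywhere, [chi] depends only on classes. *)
Definition is_character (chi : ray_algebra -> C) :=
  [/\ exists a, chi a <> 0,
      forall (k : C) (a b c : ray_algebra),
        {ae mu, forall x, val c x = k * val a x + val b x} ->
        chi c = k * chi a + chi b &
      forall a b c : ray_algebra,
        {ae mu, forall x, val c x = val a x * val b x} -> chi c = chi a * chi b].

Definition character_space : topologicalType :=
  @subspace_type {ptws ray_algebra -> C} [set chi | is_character chi].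

Definition CK : Type := continuousType character_space C.

(* The identification of the algebra with C(K): [g] is the Gelfand transform of
   the class of [a]. *)
Definition represents (a : ray_algebra) (g : CK) :=
  forall theta : character_space, g theta = val theta a.

Definition is_check (g h : CK) := exists a b : ray_algebra,
  [/\ represents a g, represents b h &
      {ae mu, forall x, val b x = val a (- (x : E))}].

Definition even_functions012 : set CK :=
  [set g | is_check g g /\ forall theta, [\/ g theta = 0, g theta = 1 | g theta = 2]].

End ordered_group.

(* Main.v *)
Require Import Defs.
From HB Require Import structures.
From mathcomp Require Import all_boot all_order all_algebra.
From mathcomp Require Import all_classical all_reals all_analysis.
From mathcomp Require Import complex ring lra.
Import Order.TTheory GRing.Theory Num.Theory.
Import numFieldNormedType.Exports.
Local Open Scope classical_set_scope.
Local Open Scope ring_scope.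

Set Implicit Arguments.
Unset Strict Implicit.
Unset Printing Implicit Defensive.

(** Write [F_t] for the function on the character space [K] given by the ray of
    the points above [t]. A character [theta] is determined by the set of those
    [t] for which [F_t] takes the value [1] at [theta]. This set is a cut of the
    ordered group; conversely every cut arises (character_of_cut), and the
    topology of [K] is convergence of cuts at each point (cvg_character_space).
    Since [E] is connected, a cut which is neither empty nor full is
    [{s <= t}] or [{s < t}] for some [t]: [K] is a double arrow space, with a
    right and a left character at each point, and continuous functions on [K]
    are functions with one-sided limits. The reflection of [E] induces an
    involution of [K] which exchanges right and left characters.

    The topology [tau'] is pointwise convergence on the right characters. They
    are dense, so [tau'] is Hausdorff; together with their reflections they
    exhaust [K], so on even functions ([Y1]) and on odd functions ([Y2]) the
    topology [tau'] is pointwise convergence on all of [K]. Multiplication by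
    the odd function [2 F_0 - 1], of square [1], exchanges [Y1] and [Y2].

    What fails for [tau'] comes from one curve. The map [t |-> F_t] is
    continuous from the left for [tau'], hence Borel: a set open for the left
    half-open topology is an open set together with countably many points
    (left_open_borel). By contrast the map [t |-> F_t - F_(-t)] separates each
    positive [t0] from all other parameters by a [tau']-open set, whose unions
    pull back to arbitrary subsets of an interval. Haar measure has no atoms and
    [E] is separable, so Vitali's argument provides a subset which is not Borel
    (non_borel_set). Hence the difference of two Borel maps, the even part
    [(1 + F_t - F_(-t)) / 2] of the Borel curve [F_t], and the open sets which
    the product curve [(F_t, F_(-t))] meets in one point give the failure of
    linearity, of measurability of the projection and of the product
    sigma-algebra. The even functions [1 + F_t - F_(-t)] themselves form the
    closed discrete set: each is isolated by its jump, and a limit of them still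
    jumps at a point because it is continuous on both sides of its cut
    (step_limit).

    For universal measurability, Haar measure on a bounded interval is pushed
    forward along [t |-> F_t] into the compactification of the space given by
    its bounded continuous functions. The image is a Radon measure, again
    because preimages of open sets are open up to countable sets
    (pushed_radon). It gives full measure to every Borel set containing the
    space. A compact set of functions, however, contains [F_t] for countably
    many [t] only: as the parameter decreases to [t], a cluster point
    would vanish at the right of [t] and be [1] at the right of every
    larger point, which no continuous function on [K] does (right_isolated).
    So every Borel subset of the space is null. *)

(** * Separable connected ordered groups *)

(** A class, so that the lemmas below take the hypotheses on the group
    implicitly. *)
Class separable_ordered_group {E : topologicalZmodType} {d : Order.disp_t}
    (ord : Order.Total d E) : Prop := {
  ord_group : forall a b : E,
    ((a : with_order ord) <= b)%O = (((a - b : E) : with_order ord) <= (0 : E))%O;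
  ord_topology : @open E = @open (order_topology (with_order ord));
  E_locally_compact : locally_compact [set: E];
  E_connected : connected [set: E];
  E_separable : separable E;
  E_uncountable : ~ countable [set: E] }.

Definition open_interval (E : topologicalZmodType) (d : Order.disp_t)
    (ord : Order.Total d E) (s t : E) : set E :=
  [set x : E | ((s : with_order ord) < x)%O /\ ((x : with_order ord) < t)%O].
Arguments open_interval {E d} ord s t.

Definition down_set (E : topologicalZmodType) (d : Order.disp_t)
    (ord : Order.Total d E) (C : set E) :=
  forall s t : E, ((s : with_order ord) <= t)%O -> C t -> C s.
Arguments down_set {E d} ord C.

Section ordered_group.
Context {E : topologicalZmodType} {d : Order.disp_t} {ord : Order.Total d E}
  {H : separable_ordered_group ord}.

Local Notation "x <o y" := ((x : with_order ord) < (y : with_order ord))%O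
  (at level 70, y at next level).
Local Notation "x <=o y" := ((x : with_order ord) <= (y : with_order ord))%O
  (at level 70, y at next level).

Lemma ole_add (c a b : E) : (a + c <=o b + c) = (a <=o b).
Proof. by rewrite ord_group [RHS]ord_group opprD addrACA subrr addr0. Qed.

Lemma olt_add (c a b : E) : (a + c <o b + c) = (a <o b).
Proof. by rewrite !ltNge ole_add. Qed.

Lemma ole_opp (a b : E) : (- a <=o - b) = (b <=o a).
Proof. by rewrite ord_group [RHS]ord_group opprK addrC. Qed.

Lemma olt_opp (a b : E) : (- a <o - b) = (b <o a).
Proof. by rewrite !ltNge ole_opp. Qed.

(** A group without positive elements is trivial, hence countable. *)
Lemma pos_exists : exists x : E, 0 <o x.
Proof.
apply: contrapT => /forallNP npos; apply: E_uncountable.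
rewrite (_ : setT = [set 0 : E]); first exact: countable1.
apply/seteqP; split => // x _ /=.
case: (ltgtP (x : with_order ord) (0 : E)) => // [x0|/npos//].
by have := npos (- x); rewrite -{1}oppr0 olt_opp.
Qed.

Lemma exists_gt (t : E) : exists u : E, t <o u.
Proof.
by have [x x0] := pos_exists; exists (x + t); rewrite -{1}[t]add0r olt_add.
Qed.

Lemma exists_lt (t : E) : exists u : E, u <o t.
Proof. by have [u u0] := exists_gt (- t); exists (- u); rewrite -[t]opprK olt_opp. Qed.

Lemma open_rray (t : E) : open [set x : E | t <o x].
Proof.
rewrite ord_topology.
have := @rray_open _ (order_topology (with_order ord)) t.
by rewrite set_itvE.
Qed.

Lemma open_lray (t : E) : open [set x : E | x <o t].
Proof.
rewrite ord_topology.
have := @lray_open _ (order_topology (with_order ord)) t.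
by rewrite set_itvE.
Qed.

Local Notation oitv := (open_interval ord).

Lemma open_oitv (s t : E) : open (oitv s t).
Proof. by apply: openI; [exact: open_rray|exact: open_lray]. Qed.

Lemma nbhs_oitv (t : E) (U : set E) : open U -> U t ->
  exists s u : E, [/\ s <o t, t <o u & oitv s u `<=` U].
Proof.
rewrite ord_topology => oU Ut.
have : @nbhs _ (order_topology (with_order ord)) t U by apply: open_nbhs_nbhs.
rewrite (@itv_nbhsE _ (order_topology (with_order ord))).
case=> -[l r] /= [oi ti] iU.
case/andP: ti => [lt tr].
have [s st ls] : exists2 s : E, s <o t & forall x : with_order ord,
    s <o x -> ((l <= BLeft x)%O : bool).
  case: l oi lt {iU} => [[] l|[]] oi //= lt; first
    by exists l => // x; rewrite bnd_simp.
  by have [s st] := exists_lt t; exists s.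
have [u tu ru] : exists2 u : E, t <o u & forall x : with_order ord,
    x <o u -> ((BRight x <= r)%O : bool).
  case: r oi tr {iU} => [[] r|[]] oi //= tr.
  - by exists r => // x; rewrite bnd_simp.
  - by case: l oi {lt ls} => [[]?|[]].
  - by have [u tu] := exists_gt t; exists u.
exists s, u; split => // x [sx xu]; apply: iU => /=.
by apply/andP; split; [exact: ls|exact: ru].
Qed.

(** A gap would make [{x < t}] a clopen proper subset of the connected group. *)
Lemma odense (s t : E) : s <o t -> exists u : E, oitv s t u.
Proof.
move=> st; apply: contrapT => /forallNP gap.
have clA : [set x : E | x <o t] = [set x : E | x <=o s].
  apply/seteqP; split => x /=; last by move/le_lt_trans; apply.
  by move=> xt; rewrite leNgt; apply/negP => sx; apply: (gap x).
have : [set x : E | x <o t] = setT.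
  apply: E_connected.
  - by exists s.
  - by exists [set x : E | x <o t]; [exact: open_lray|rewrite setTI].
  - exists [set x : E | x <o t]; last by rewrite setTI.
    rewrite clA -openC (_ : ~` _ = [set x : E | s <o x]); first exact: open_rray.
    by apply/seteqP; split => x /=; rewrite ltNge => /negP.
by move=> /seteqP[_ /(_ t Logic.I)] /=; rewrite ltxx.
Qed.

(** A cut with neither a greatest element nor a complement with a least one
    would be clopen: this is where connectedness makes every proper cut
    principal, so that the character space is a double arrow space. *)
Lemma cut_max_or_min (C : set E) : down_set ord C -> C !=set0 -> C != setT ->
  (exists t, C = [set s : E | s <=o t]) \/ (exists t, C = [set s : E | s <o t]).
Proof.
move=> dC C0 /eqP CT; apply: contrapT => /not_orP[/forallNP nmax /forallNP nmin].
apply: CT; apply: E_connected => //.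
- exists C; last by rewrite setTI.
  rewrite openE => t Ct; rewrite /interior /=.
  have [s [ts Cs]] : exists s : E, t <o s /\ C s.
    apply: contrapT => /forallNP nC; apply: (nmax t); apply/seteqP; split => s /=.
      by move=> Cs; rewrite leNgt; apply/negP => ts; apply: (nC s).
    by move=> /dC; exact.
  apply: filterS (open_nbhs_nbhs (conj (open_lray s) ts)) => u /= us.
  by apply: dC Cs; exact: ltW.
- exists C; last by rewrite setTI.
  rewrite -openC openE => t nCt; rewrite /interior /=.
  have [s [ts nCs]] : exists s : E, s <o t /\ ~ C s.
    apply: contrapT => /forallNP nC; apply: (nmin t); apply/seteqP; split => s /=.
      by move=> Cs; rewrite ltNge; apply/negP => /dC /(_ Cs).
    by move=> st; apply: contrapT => nCs; apply: (nC s).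
  apply: filterS (open_nbhs_nbhs (conj (open_rray s) ts)) => u /= us Cu.
  by apply: nCs; apply: dC Cu; exact: ltW.
Qed.

(** The intervals that isolate distinct points of [Z] from the left are
    disjoint, and each contains a point of a countable dense set. Every
    countability statement about the half-open topology comes from here. *)
Lemma left_isolated_countable (Z : set E) :
  (forall t, Z t -> exists2 s : E, s <o t & oitv s t `&` Z = set0) -> countable Z.
Proof.
move=> iso; have [D cD dD] := E_separable.
have [f fP] : {f : E -> E & forall t, Z t ->
    f t <o t /\ oitv (f t) t `&` Z = set0 }.
  apply: (@choice _ _ (fun t s => Z t -> s <o t /\ oitv s t `&` Z = set0)) => t.
  have [Zt|nZt] := pselect (Z t); last by exists t.
  by have [s ? ?] := iso t Zt; exists s.
have [g gP] : {g : E -> E & forall t, Z t -> D (g t) /\ oitv (f t) t (g t)}.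
  apply: (@choice _ _ (fun t s => Z t -> D s /\ oitv (f t) t s)) => t.
  have [Zt|nZt] := pselect (Z t); last by exists t.
  have [ft _] := fP t Zt.
  have [u uI] := odense ft.
  have [s [sI Ds]] := dD (oitv (f t) t) (ex_intro _ u uI) (open_oitv _ _).
  by exists s.
have ginj : {in Z &, injective g}.
  move=> s t /set_mem Zs /set_mem Zt gst.
  wlog st : s t Zs Zt gst / s <o t.
    case: (ltgtP (s : with_order ord) t) => // [st /(_ s t)|ts /(_ t s)]; first exact.
    by move=> h; apply/esym/h.
  have [_ [fg gt]] := gP t Zt; have [_ [fg' gs]] := gP s Zs.
  have [_ dis] := fP t Zt; exfalso.
  have : (oitv (f t) t `&` Z) s.
    by split => //; split => //; apply: lt_trans fg _; rewrite -gst.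
  by rewrite dis.
have : countable (g @` Z).
  by apply: sub_countable cD; apply: subset_card_le => _ [t /gP[? _] <-].
by rewrite (eq_countable (inj_card_eq ginj)).
Qed.

End ordered_group.

(** * Countable unions, Borel functions and finite subcovers *)

(** Countable index sets are reduced to [nat], where the closure properties of
    sigma-algebras and of null sets are stated. *)
Lemma enum_bigcup (T X : Type) (D : set T) (F : T -> set X) : countable D ->
  exists2 G : nat -> set X, \bigcup_(x in D) F x = \bigcup_n G n &
    forall n, G n = set0 \/ exists2 x, D x & G n = F x.
Proof.
move=> /countable_injP[f finj].
exists (fun n => \bigcup_(x in [set x | D x /\ f x = n]) F x).
  apply/seteqP; split => [y [x Dx Fy]|y [n _ [x [Dx _] Fy]]]; last by exists x.
  by exists (f x) => //; exists x.
move=> n; have [[x [Dx fx]]|nx] := pselect (exists x, D x /\ f x = n).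
  right; exists x => //; apply/seteqP; split => [y [z [Dz fz] Fy]|y Fy]; last by exists x.
  by rewrite (finj x z) ?inE // fx fz.
by left; apply/seteqP; split => // y [x [Dx fx] _]; apply: nx; exists x.
Qed.

Lemma borel_preimage_generated (X : topologicalType) (Y : Type) (f : X -> Y)
    (G : set (set Y)) :
  (forall A, G A -> borel_sets (f @^-1` A)) ->
  forall A, <<s G >> A -> borel_sets (f @^-1` A).
Proof.
move=> fG; suff : <<s G >> `<=` [set A | borel_sets (f @^-1` A)] by apply.
have [s0 sD sU] := smallest_sigma_algebra setT (@open X).
apply: smallest_sub => //; split.
- by rewrite /= preimage_set0.
- by move=> A bA /=; rewrite setTD preimage_setC -setTD; exact: sD.
- by move=> A bA /=; rewrite preimage_bigcup; exact: sU.
Qed.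

Lemma borel_fun_open (X Y : topologicalType) (f : X -> Y) :
  (forall U, open U -> borel_sets (f @^-1` U)) -> borel_fun f.
Proof. exact: borel_preimage_generated. Qed.

Lemma continuous_borel_fun (X Y : topologicalType) (f : X -> Y) :
  continuous f -> borel_fun f.
Proof.
move=> cf; apply: borel_fun_open => U oU.
by apply: sub_gen_smallest; exact: open_comp.
Qed.

(** Open covers characterize compactness for pointed spaces; the point [x0]
    supplies the pointed structure. *)
Lemma finite_subcover (X : topologicalType) (x0 : X) (C : set X) (I : choiceType)
    (D : set I) (f : I -> set X) :
  compact C -> (forall i, D i -> open (f i)) -> C `<=` \bigcup_(i in D) f i ->
  exists D' : set I, [/\ finite_set D', D' `<=` D & C `<=` \bigcup_(i in D') f i].
Proof.
pose pX := HB.pack_for ptopologicalType X (isPointed.Build X x0).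
move=> cC fo Cf; have h : @cover_compact pX C by rewrite -compact_cover.
have [D' D'D CD'] := h I D f fo Cf.
eexists; split; last exact: CD'.
  exact: finite_fset.
by move=> i /D'D /set_mem.
Qed.

(** * Haar measure and a non-Borel set *)

Existing Class haar_measure.

Section haar.
Context {R : realType} {E : topologicalZmodType} {d : Order.disp_t}
  {ord : Order.Total d E} {H : separable_ordered_group ord}.
Local Notation "x <o y" := ((x : with_order ord) < (y : with_order ord))%O
  (at level 70, y at next level).
Local Notation oitv := (open_interval ord).

(** An open interval stays infinite on a dense set: after removing a point, an
    interval remains to its left. *)
Lemma dense_avoid (D : set E) (l : seq E) (s t : E) : dense D -> s <o t ->
  exists2 u : E, (oitv s t `&` D) u & u \notin l.
Proof.
move=> dD; elim: l t => [|a l IH] t st.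
  have [u uI] := odense st.
  have [v [? ?]] := dD (oitv s t) (ex_intro _ u uI) (open_oitv _ _).
  by exists v.
have [u [[su ut] Du] ul] := IH t st.
have [ua|ua] := eqVneq u a; last by exists u; rewrite // inE negb_or ua.
have [v [[sv vu] Dv] vl] := IH u su; exists v.
  by split => //; split => //; exact: lt_trans vu ut.
by rewrite inE negb_or vl andbT -ua; apply/eqP => vu'; move: vu; rewrite vu' ltxx.
Qed.

Lemma oitv_dense_infinite (D : set E) (s t : E) : dense D -> s <o t ->
  infinite_set (oitv s t `&` D).
Proof.
move=> dD st /finite_seqP[l lE]; have [u] := dense_avoid l dD st.
by rewrite lE /= => ->.
Qed.

Lemma ordered_group_hausdorff : hausdorff_space E.
Proof.
rewrite open_hausdorff => x y xy.
wlog {xy} xy : x y / x <o y.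
  move: xy; case: (ltgtP (x : with_order ord) y) => [xy _ h|yx _ h|->].
  - exact: h.
  - have [[A B] [? ?] [? ? AB0]] := h y x yx.
    by exists (B, A); split => //=; rewrite setIC.
  - by rewrite eqxx.
have [z [xz zy]] := odense xy.
exists ([set u : E | u <o z], [set u : E | z <o u]) => /=.
  by rewrite !inE.
split; [exact: open_lray|exact: open_rray|].
by apply/eqP/seteqP; split => // u /= [/lt_trans h /h]; rewrite ltxx.
Qed.

Lemma open_borel (U : set E) : open U -> measurable (U : set (borel_type E)).
Proof. exact: sub_gen_smallest. Qed.

Lemma closed_borel (U : set E) : closed U -> measurable (U : set (borel_type E)).
Proof. by move=> cU; rewrite -[U]setCK; apply: measurableC; apply: open_borel; rewrite openC. Qed.

Lemma set1_borel (t : E) : measurable ([set t] : set (borel_type E)).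
Proof.
rewrite (_ : [set t] = ~` ([set x : E | x <o t] `|` [set x : E | t <o x])).
  apply: measurableC; apply: open_borel; apply: openU; [exact: open_lray|exact: open_rray].
apply/seteqP; split => x /=; first by move=> ->; rewrite ltxx => -[].
by move=> /not_orP[]; case: (ltgtP (x : with_order ord) t).
Qed.

Lemma measurable_bigcup_countable (T : choiceType) (D : set T) (F : T -> set E) :
  countable D -> (forall x, D x -> measurable (F x : set (borel_type E))) ->
  measurable (\bigcup_(x in D) F x : set (borel_type E)).
Proof.
move=> cD mF; have [G -> GF] := enum_bigcup F cD.
by apply: bigcupT_measurable => n; have [->//|[x /mF ? ->]] := GF n.
Qed.

Lemma countable_borel (A : set E) : countable A -> measurable (A : set (borel_type E)).
Proof.
move=> cA; rewrite (_ : A = \bigcup_(x in A) [set x]); last first.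
  by apply/seteqP; split => [x Ax|x [y Ay ->]] //; exists x.
by apply: measurable_bigcup_countable => // x _; exact: set1_borel.
Qed.

Lemma translate_continuous (a : E) : continuous (fun x : E => x - a).
Proof.
move=> x; apply: (@continuous_comp _ _ _ (fun x : E => (x, a)) (fun p => p.1 - p.2)).
  by apply: cvg_pair => //=; exact: cvg_cst.
exact: sub_continuous.
Qed.

Lemma translateE (a : E) (A : set E) : [set a + x | x in A] = (fun x => x - a) @^-1` A.
Proof.
apply/seteqP; split => [_ [x Ax <-]|x Ax] /=; first by rewrite addrC addKr.
by exists (x - a) => //; rewrite addrC subrK.
Qed.

Context {mu : {measure set (borel_type E) -> \bar R}} {Hmu : haar_measure mu}.

Lemma mu_translate (a : E) (A : set E) : borel_sets A ->
  mu [set a + x | x in A] = mu A.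
Proof. by case: Hmu => _ h _ _ _; exact: h. Qed.

Lemma mu_compact (A : set E) : compact A -> (mu A < +oo)%E.
Proof. by case: Hmu => _ _ h _ _; exact: h. Qed.

Lemma translate_borel (a : E) (A : set E) : borel_sets A ->
  borel_sets [set a + x | x in A].
Proof.
move=> bA; rewrite translateE; apply: (@continuous_borel_fun E E) bA.
exact: translate_continuous.
Qed.

Lemma negligible_bigcup_countable (T : choiceType) (D : set T) (F : T -> set E) :
  countable D -> (forall x, D x -> mu.-negligible (F x)) ->
  mu.-negligible (\bigcup_(x in D) F x).
Proof.
move=> cD mF; have [G -> GF] := enum_bigcup F cD.
apply: negligible_bigcup => n; have [->|[x /mF ? ->]//] := GF n.
exact: negligible_set0.
Qed.

(** If a nonempty open set were null, so would be every compact set, which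
    finitely many of its translates cover, and then the whole group by inner
    regularity. *)
Lemma mu_open_pos (U : set E) : open U -> U !=set0 -> mu U != 0.
Proof.
move=> oU [u Uu]; apply/negP => /eqP U0.
have tU a : open [set a + x | x in U].
  by rewrite translateE; apply: open_comp => // x _; exact: translate_continuous.
have C0 (C : set E) : compact C -> borel_sets C -> mu C = 0.
  move=> cC bC.
  have [i _|x _|D' [fD' _ CD]] := @finite_subcover E (0 : E) C E setT
    (fun a => [set a + x | x in U]) cC.
  - exact: tU.
  - by exists (x - u) => //; exists u => //; rewrite subrK.
  apply: measure_negligible; first exact: bC.
  apply: (@negligibleS _ (borel_type E) R mu _ _ CD).
  apply: negligible_bigcup_countable.
    exact: finite_set_countable fD'.
  move=> x _; apply/negligibleP; first exact: open_borel.
  by rewrite -U0; apply: mu_translate; exact: open_borel.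
case: Hmu => muT _ _ _ /(_ setT openT) inner; move/eqP: muT; apply.
rewrite inner; apply/eqP; rewrite eq_le; apply/andP; split; last first.
  apply: ereal_sup_ubound; exists set0; last by rewrite measure0.
  by split => //; exact: compact0.
apply: ge_ereal_sup => _ [C [cC _] <-]; rewrite C0 //.
apply: closed_borel; apply: compact_closed => //; exact: ordered_group_hausdorff.
Qed.

End haar.

Section haar_non_borel.
Context {R : realType} {E : topologicalZmodType} {d : Order.disp_t}
  {ord : Order.Total d E} {H : separable_ordered_group ord}.
Context {mu : {measure set (borel_type E) -> \bar R}} {Hmu : haar_measure mu}.
Local Notation "x <o y" := ((x : with_order ord) < (y : with_order ord))%O
  (at level 70, y at next level).
Local Notation "x <=o y" := ((x : with_order ord) <= (y : with_order ord))%O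
  (at level 70, y at next level).
Local Notation oitv := (open_interval ord).

(** By local compactness: compact neighbourhoods of [0] have finite measure. *)
Lemma finite_interval : exists2 c : E, 0 <o c & (mu (oitv (- c)%R c) < +oo)%E.
Proof.
have [U U0 [cU clU]] := @E_locally_compact _ _ _ H 0 I.
have {}U0 : nbhs (0 : E) U by move: U0; rewrite withinET.
have [s [u [s0 u0 sU]]] := nbhs_oitv (open_interior U) U0.
have [c [c0 [cs cu]]] : exists c : E, 0 <o c /\ (s <=o - c /\ c <=o u).
  have s0' : 0 <o - s by rewrite -{1}oppr0 olt_opp.
  case: (leP (- s : with_order ord) u) => su.
    by exists (- s); rewrite opprK; split => //; split => //; exact: lexx.
  by exists u; split => //; split => //; rewrite -[s]opprK ole_opp ltW.
exists c => //; apply: le_lt_trans (mu_compact cU).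
apply: le_measure; rewrite ?inE.
- by apply: open_borel; exact: open_oitv.
- exact: closed_borel.
move=> x [cx xc]; apply: interior_subset; apply: sU.
by split; [exact: le_lt_trans cs cx|exact: lt_le_trans xc cu].
Qed.

(** Infinitely many disjoint translates of [A] fit into a set of finite
    measure. This is applied to singletons and to a Vitali set. *)
Lemma packing_null (A B S : set E) : borel_sets A -> borel_sets B ->
  (mu B < +oo)%E -> infinite_set S ->
  (forall s, S s -> [set s + x | x in A] `<=` B) ->
  (forall s t a b, S s -> S t -> A a -> A b -> s + a = t + b -> s = t) ->
  mu A = 0%E.
Proof.
move=> bA bB Bfin /infiniteP/card_leP[f0] SB disj.
pose f n : E := val (f0 (to_setT n)).
have Sf n : S (f n) by exact/set_mem/valP.
have finj : injective f.
  by move=> i j /val_inj/(inj (mem_setT _) (mem_setT _))/(congr1 val).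
pose F n := [set f n + x | x in A].
have mF n : measurable (F n : set (borel_type E)) by exact: translate_borel.
have tF : trivIset setT F.
  apply/trivIsetP => i j _ _ ij; apply/seteqP; split => // x [[a Aa <-] [b Ab]].
  by move=> /disj => /(_ (Sf j) (Sf i) Ab Aa)/finj ji; rewrite ji eqxx in ij.
have le n : (\sum_(i < n) mu A <= mu B)%E.
  rewrite (eq_bigr (fun i : 'I_n => mu (F i))); last first.
    by move=> i _; apply/esym; exact: mu_translate.
  rewrite -(@measure_semi_additive_ord_I _ (borel_type E) R mu F).
  - apply: le_measure; rewrite ?inE //.
      by apply: bigsetU_measurable.
    by rewrite -bigcup_mkord => x [i _ Fx]; apply: SB Fx.
  - by [].
  - by apply: sub_trivIset tF.
  - by apply: bigsetU_measurable.
apply/eqP; rewrite -measure_le0 leNgt; apply/negP => A0.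
have Afin : (mu A < +oo)%E by have := le 1%N; rewrite big_ord1 => /le_lt_trans; apply.
have /fineK eA : mu A \is a fin_num by rewrite ge0_fin_numE.
have /fineK eB : mu B \is a fin_num by rewrite ge0_fin_numE.
have a0 : 0 < fine (mu A) by rewrite -lte_fin eA.
have b0 : 0 <= fine (mu B) by rewrite -lee_fin eB.
have := le (Num.bound (fine (mu B) / fine (mu A))).
rewrite -eA -eB sumEFin lee_fin sumr_const card_ord -mulr_natl.
have := archi_boundP (divr_ge0 b0 (ltW a0)).
by rewrite ltr_pdivrMr // => /lt_le_trans h /h; rewrite ltxx.
Qed.

(** The bound [a] plays the role of half of [c]; it comes from
    density of the order, the group not being assumed divisible. *)
Lemma half_interval (c : E) : 0 <o c -> exists2 a : E, 0 <o a &
  forall x y, oitv 0 a x -> oitv 0 a y -> oitv (- c) c (x + y).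
Proof.
move=> c0; have [b [b0 bc]] := odense c0.
have [a [a0 [ab acb]]] : exists a : E, 0 <o a /\ (a <=o b /\ a <=o c - b).
  have cb0 : 0 <o c - b by rewrite -(subrr b) olt_add.
  case: (leP (b : with_order ord) (c - b)) => su; first by exists b.
  by exists (c - b); split => //; split => //; exact: ltW.
exists a => // x y [x0 xa] [y0 ya]; split.
  apply: (@lt_trans _ _ (0 : with_order ord)).
    by rewrite -[X in _ <o X]oppr0 olt_opp.
  by apply: (lt_trans y0); rewrite -{1}[y]add0r olt_add.
apply: (@lt_le_trans _ _ ((a + y : E) : with_order ord)); first by rewrite olt_add.
apply: (@le_trans _ _ ((a + b : E) : with_order ord)); last by rewrite -[c](subrK b) ole_add.
by rewrite ![a + _]addrC ole_add; apply: le_trans ab; exact: ltW.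
Qed.

Lemma denseT : dense [set: E].
Proof. by move=> O O0 _; rewrite setIT. Qed.

Lemma mu_set1 (t : E) : mu [set t] = 0%E.
Proof.
have [c c0 cfin] := finite_interval; have [a a0 aP] := half_interval c0.
have [u uI] := odense a0.
rewrite -[t](subrK u) -[X in mu X]/([set _ + _]) -image_set1 mu_translate; last exact: set1_borel.
apply: (@packing_null _ (oitv (- c) c) (oitv 0 a)) cfin _ _ _.
- exact: set1_borel.
- by apply: open_borel; exact: open_oitv.
- by rewrite -[oitv 0 a]setIT; apply: oitv_dense_infinite => //; exact: denseT.
- by move=> s sI _ [_ -> <-]; exact: aP.
- by move=> s r _ _ _ _ -> -> /addIr.
Qed.

Lemma countable_negligible (A : set E) : countable A -> mu.-negligible A.
Proof.
move=> cA; rewrite (_ : A = \bigcup_(x in A) [set x]); last first.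
  by apply/seteqP; split => [x Ax|x [y Ay ->]] //; exists x.
apply: negligible_bigcup_countable => // x _; apply/negligibleP.
  exact: set1_borel.
exact: mu_set1.
Qed.

(** Finite signed sums of the elements of a countable dense set. *)
Lemma dense_countable_subgroup : exists G : set E,
  [/\ countable G, dense G, G 0 & forall x y, G x -> G y -> G (x - y)].
Proof.
have [D /countable_injP[f finj] dD] := E_separable.
pose g n := xget (0 : E) [set x | D x /\ f x = n].
have gD x : D x -> g (f x) = x.
  move=> Dx; rewrite /g; case: xgetP => [y -> [Dy fy]|/(_ x)]; last by case.
  by apply: finj; rewrite ?inE.
pose term (p : bool * nat) : E := if p.1 then - g p.2 else g p.2.
pose value (l : seq (bool * nat)) : E := \sum_(p <- l) term p.
have valueN l : value [seq (~~ p.1, p.2) | p <- l] = - value l.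
  rewrite /value big_map -sumrN; apply: eq_bigr => -[[] n] _ //=.
  by rewrite /term /= opprK.
exists (range value); split.
- by apply: card_le_trans (card_image_le _ _) _; exact: countableP.
- move=> O O0 oO; have [x [Ox Dx]] := dD O O0 oO; exists x; split => //.
  by exists [:: (false, f x)] => //; rewrite /value big_seq1 /term /= gD.
- by exists [::] => //; rewrite /value big_nil.
- move=> _ _ [l _ <-] [l' _ <-]; exists (l ++ [seq (~~ p.1, p.2) | p <- l']) => //.
  by rewrite -valueN /value big_cat.
Qed.

(** Vitali's argument, with a countable dense subgroup [G] instead of the
    rationals. Representatives of the cosets of [G] chosen in [oitv 0 a] have
    infinitely many disjoint translates inside an interval of finite measure,
    so a Borel set of representatives would be null, and with it the group,
    which is the union of the translates of that set by [G]. *)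
Lemma non_borel_set : exists c : E, exists V : set E,
  [/\ 0 <o c, V `<=` oitv 0 c & ~ borel_sets V].
Proof.
have [c c0 cfin] := finite_interval; have [a a0 aP] := half_interval c0.
have [G [cG dG G0 GB]] := dense_countable_subgroup.
have GN x : G x -> G (- x) by move=> Gx; rewrite -[- x]sub0r; exact: GB.
have GD x y : G x -> G y -> G (x + y).
  by move=> Gx Gy; rewrite -[y]opprK; apply: GB => //; exact: GN.
(* By density of [G], each coset has a representative in [oitv 0 a]; [r x] is
   the one chosen for the coset of [x]. *)
pose coset x := [set y | oitv 0 a y /\ G (x - y)].
pose r x := xget (0 : E) (coset x).
have rP x : coset x (r x).
  rewrite /r; case: xgetP => // none.
  have [u uI] : exists u : E, oitv (x - a) x u.
    by apply: odense; rewrite -{2}[x]subr0 ![x - _]addrC olt_add olt_opp.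
  have [g [[ag gx] Gg]] := dG _ (ex_intro _ u uI) (open_oitv _ _).
  case: (none (x - g)); split; last by rewrite opprB addrC subrK.
  split; first by rewrite -(subrr g) olt_add.
  by move: ag; rewrite -(olt_add (a - g)) addrA subrK addrCA subrr addr0.
have req x y : G (x - y) -> r x = r y.
  move=> Gxy; rewrite /r; congr xget; apply/seteqP; split => z [zI Gz]; split => //.
    by rewrite -(subrK x y) -addrA; apply: GD => //; rewrite -opprB; exact: GN.
  by rewrite -(subrK y x) -addrA; apply: GD.
exists a, (range r); split => //; first by move=> _ [x _ <-]; have [] := rP x.
move=> bV.
have V0 : mu (range r) = 0%E.
  apply: (@packing_null _ (oitv (- c) c) (oitv 0 a `&` G)) cfin _ _ _ => //.
  - by apply: open_borel; exact: open_oitv.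
  - exact: oitv_dense_infinite.
  - by move=> s [sI _] _ [_ [x _ <-] <-]; apply: aP => //; have [] := rP x.
  - move=> s t _ _ [_ Gs] [_ Gt] [x _ <-] [y _ <-] e.
    have rr : r (r x) = r (r y).
      apply: req; rewrite (_ : r x - r y = t - s); first exact: GB.
      by apply/eqP; rewrite subr_eq; apply/eqP/(@addrI _ s); rewrite e addrA addrCA subrr addr0.
    have rK z : r (r z) = r z.
      by apply: req; rewrite -opprB; apply: GN; have [] := rP z.
    by move: e; rewrite -(rK x) rr rK => /addIr.
have : mu.-negligible [set: E].
  apply: (@negligibleS _ (borel_type E) R mu
    (\bigcup_(h in G) [set h + v | v in range r])).
    move=> x _; exists (x - r x); first by have [] := rP x.
    by exists (r x); [exists x|rewrite subrK].
  apply: negligible_bigcup_countable => // h _; apply/negligibleP.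
    exact: translate_borel.
  by rewrite -V0; exact: mu_translate.
move=> /negligibleP => /(_ measurableT) muT.
by case: Hmu => /eqP + _ _ _ _; rewrite muT.
Qed.

End haar_non_borel.

(** * Complex-valued Borel functions *)

Lemma fmap_ultra (T U : Type) (f : T -> U) (F : set_system T) :
  UltraFilter F -> UltraFilter (f @ F).
Proof.
move=> FU; split; first exact: fmap_proper_filter.
move=> G PG FG; apply/seteqP; split => A GA; last exact: FG.
have [//|nA] := in_ultra_setVsetC (f @^-1` A) FU.
have : G (~` A) by exact: FG.
by move=> /(filterI GA); rewrite setICr => /filter_ex[].
Qed.

Lemma borel_setI (X : topologicalType) (A B : set X) :
  borel_sets A -> borel_sets B -> borel_sets (A `&` B).
Proof.
move=> bA bB; have [s0 sD sU] := smallest_sigma_algebra setT (@open X).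
rewrite (_ : A `&` B = setT `\` \bigcup_n (if n is 0 then setT `\` A else setT `\` B)).
  by apply: (sD); apply: sU => -[|n]; exact: sD.
apply/seteqP; split => [x [Ax Bx]|x [_ nx]].
  by split => // -[[|n] _ []].
by split; apply: contrapT => nX; apply: nx; [exists 0%N|exists 1%N].
Qed.

Section complex_numbers.
Context {R : realType}.
Local Notation C := (Cplx R).
Local Open Scope complex_scope.
Local Notation Re := (@complex.Re R : C -> R).
Local Notation Im := (@complex.Im R : C -> R).

Lemma norm_ge_Re (z : C) : `|Re z|%:C <= `|z|.
Proof. exact: normc_ge_Re. Qed.

Lemma norm_le_Re_Im (z : C) : `|z| <= (`|Re z| + `|Im z|)%:C.
Proof.
rewrite {1}[z]complexE; apply: le_trans (ler_normD _ _) _.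
rewrite rmorphD /= normrM !normc_def /= !expr0n /= !addr0 !add0r expr1n sqrtr1 mul1r.
by rewrite !sqrtr_sqr.
Qed.

Lemma norm_ge_Im (z : C) : `|Im z|%:C <= `|z|.
Proof.
rewrite normc_def lecR -sqrtr_sqr ler_sqrt ?lerDr ?sqr_ge0//.
by rewrite addr_ge0 ?sqr_ge0.
Qed.

Lemma pos_real (e : C) : 0 < e -> exists2 r : R, 0 < r & e = r%:C.
Proof.
case: e => a b; rewrite ltcE /= => /andP[/eqP -> a0].
by exists a.
Qed.

(** Convergence phrased with arbitrary filters, including those which are not
    proper: most filters below are built by hand. *)
Lemma cvgC_distP (T : Type) (F : set_system T) (f : T -> C) (z : C) : Filter F ->
  f @ F --> z <-> forall e : C, 0 < e -> F [set t | `|z - f t| < e].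
Proof.
move=> FF; split => [fz e e0|h U /nbhs_ballP[e /= e0 eU]].
  apply: (fz [set w | `|z - w| < e]); apply/nbhs_ballP; exists e => //.
by apply: (@filterS _ F FF _ _ _ (h e e0)) => t zt; exact: (eU _ zt).
Qed.

Lemma cvgC_unique (T : Type) (F : set_system T) (f : T -> C) (z w : C) :
  ProperFilter F -> f @ F --> z -> f @ F --> w -> z = w.
Proof. by move=> FF; apply: cvg_unique; exact: norm_hausdorff. Qed.

Lemma Re_continuous : continuous Re.
Proof.
move=> z U /nbhs_ballP[e /= e0 eU]; apply/nbhs_ballP.
exists e%:C => /=; first by rewrite ltcR.
move=> w zw; apply: eU; have {}zw : `|z - w| < e%:C := zw.
suff : `|Re z - Re w| < e by [].
by rewrite -raddfB -ltcR; exact: le_lt_trans (norm_ge_Re _) zw.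
Qed.

Lemma Im_continuous : continuous Im.
Proof.
move=> z U /nbhs_ballP[e /= e0 eU]; apply/nbhs_ballP.
exists e%:C => /=; first by rewrite ltcR.
move=> w zw; apply: eU; have {}zw : `|z - w| < e%:C := zw.
suff : `|Im z - Im w| < e by [].
by rewrite -raddfB -ltcR; exact: le_lt_trans (norm_ge_Im _) zw.
Qed.

Lemma complex_cvg (T : Type) (F : set_system T) (FF : Filter F) (f : T -> C) (z : C) :
  Re (f x) @[x --> F] --> Re z -> Im (f x) @[x --> F] --> Im z -> f @ F --> z.
Proof.
move=> fR fI; apply/cvgrPdist_lt => e /pos_real[r r0 ->]; near=> x.
apply: le_lt_trans (norm_le_Re_Im _) _; rewrite ltcR [ltRHS]splitr !raddfB /= ltrD//.
- by near: x; apply: cvgr_dist_lt => //; rewrite divr_gt0.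
- by near: x; apply: cvgr_dist_lt => //; rewrite divr_gt0.
Unshelve. all: by end_near. Qed.

(** This produces the values of a character at once on all bounded functions. *)
Lemma bounded_ultra_cvg (T : Type) (F : set_system T) (FU : UltraFilter F)
    (f : T -> C) (M : C) : F [set x | `|f x| <= M] -> exists z : C, f @ F --> z.
Proof.
move=> fM.
have real_part (g : C -> R) : (forall z, `|g z|%:C <= `|z|) ->
    exists r : R, g (f x) @[x --> F] --> r.
  move=> gle; have := @segment_compact R (- Re M) (Re M); rewrite compact_ultra.
  move=> /(_ ((g \o f) @ F) (fmap_ultra _ _)) [|r [_ cr]]; last by exists r.
  suff : F [set x | g (f x) \in `[- Re M, Re M]] by [].
  apply: filterS fM => x /= /(le_trans (gle _)).
  by rewrite lecE /= => /andP[_]; rewrite in_itv /= -ler_norml.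
have [a fa] := real_part _ norm_ge_Re.
have [b fb] := real_part _ norm_ge_Im.
by exists (a +i* b); exact: complex_cvg.
Qed.

(** Boxes with rational vertices form a countable base: through it an open set
    of the product of two planes is a countable union of rectangles, which makes
    pointwise operations on Borel functions Borel. *)
Definition rational_box (p : (rat * rat) * (rat * rat)) : set C :=
  [set z : C | Re z \in `]ratr p.1.1, ratr p.1.2[%R /\
               Im z \in `]ratr p.2.1, ratr p.2.2[%R].

Lemma open_rational_box p : open (rational_box p).
Proof.
apply: openI.
- apply: (@open_comp _ _ Re [set` `]ratr p.1.1, ratr p.1.2[%R]).
    by move=> z _; exact: Re_continuous.
  exact: itv_open.
- apply: (@open_comp _ _ Im [set` `]ratr p.2.1, ratr p.2.2[%R]).
    by move=> z _; exact: Im_continuous.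
  exact: itv_open.
Qed.

Lemma rational_box_base (U : set C) (z : C) : nbhs z U ->
  exists2 p, rational_box p z & rational_box p `<=` U.
Proof.
move=> /nbhs_ballP[e /= /pos_real[r r0 ->] eU].
have near_rat (x : R) : exists q : rat * rat, x \in `]ratr q.1, ratr q.2[%R /\
    forall y, y \in `]ratr q.1, ratr q.2[%R -> `|x - y| < r / 2.
  have xl : x - r / 4 < x by rewrite gtrBl divr_gt0.
  have [q qI] := rat_in_itvoo xl.
  have xr : x < x + r / 4 by rewrite ltrDl divr_gt0.
  have [q' qI'] := rat_in_itvoo xr.
  exists (q, q') => /=; rewrite !in_itv /= in qI qI' *.
  split; first by move: qI qI' => /andP[_ ->] /andP[-> _].
  move=> y; rewrite in_itv /= => yI; rewrite ltr_norml; apply/andP; split; lra.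
have [p [pz pU]] := near_rat (Re z); have [q [qz qU]] := near_rat (Im z).
exists (p, q) => // w [wp wq]; apply: eU.
rewrite -ball_normE /=; apply: le_lt_trans (norm_le_Re_Im _) _.
by rewrite ltcR [ltRHS]splitr !raddfB ltrD // ?pU ?qU.
Qed.

Lemma borel_fun_pair (X : topologicalType) (f g : X -> C) (h : C * C -> C) :
  continuous h -> borel_fun f -> borel_fun g -> borel_fun (fun x => h (f x, g x)).
Proof.
move=> ch bf bg; apply: borel_fun_open => U oU.
have [s0 sD sU] := smallest_sigma_algebra setT (@open X).
pose D := [set p | rational_box p.1 `*` rational_box p.2 `<=` h @^-1` U].
pose F p := (f @^-1` rational_box p.1) `&` (g @^-1` rational_box p.2).
have [G UG GF] := enum_bigcup F (countableP D).
rewrite (_ : _ @^-1` _ = \bigcup_(p in D) F p).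
  rewrite UG; apply: sU => n; have [->//|[p _ ->]] := GF n.
  have mf : borel_sets (f @^-1` rational_box p.1).
    by apply: bf; apply: sub_gen_smallest; exact: open_rational_box.
  have mg : borel_sets (g @^-1` rational_box p.2).
    by apply: bg; apply: sub_gen_smallest; exact: open_rational_box.
  exact: borel_setI.
apply/seteqP; split => x /=.
  move=> hU; have /ch : nbhs (h (f x, g x)) U by exact: open_nbhs_nbhs.
  move=> [[P Q] /= [/rational_box_base[p pf pP] /rational_box_base[q qg qQ]] PQ].
  exists (p, q); last by split.
  by move=> [z w] [/= /pP ? /qQ ?]; exact: PQ.
by move=> [p pU [fp gp]]; apply: (pU (f x, g x)).
Qed.

End complex_numbers.

(** * The algebra generated by the rays *)

#[local] Instance ae_borel_filter (R : realType) (E : topologicalZmodType)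
  (mu : {measure set (borel_type E) -> \bar R}) : Filter (nbhs (almost_everywhere mu)).
Proof. exact: (@ae_filter_ringOfSetsType _ (borel_type E)). Qed.

Section ray_algebra.
Context {R : realType} {E : topologicalZmodType} {d : Order.disp_t}
  {ord : Order.Total d E} {H : separable_ordered_group ord}.
Context {mu : {measure set (borel_type E) -> \bar R}} {Hmu : haar_measure mu}.
Local Notation "x <o y" := ((x : with_order ord) < (y : with_order ord))%O
  (at level 70, y at next level).
Local Notation C := (Cplx R).
Local Notation ray := (ray_indicator R ord).
Local Notation A := (ray_algebra ord mu).

Lemma conj_continuous : continuous (Num.conj : C -> C).
Proof.
move=> z U /nbhs_ballP[e /= e0 eU]; apply/nbhs_ballP; exists e => // w zw.
apply: eU; have {}zw : `|z - w| < e := zw.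
suff : `|z^* - w^*| < e by [].
by rewrite -rmorphB norm_conjC.
Qed.

Lemma borel_fun_comp (X Y Z : topologicalType) (f : X -> Y) (g : Y -> Z) :
  borel_fun f -> borel_fun g -> borel_fun (g \o f).
Proof. by move=> bf bg B bB; exact: (bf _ (bg _ bB)). Qed.

Lemma borel_cst (X Y : topologicalType) (c : Y) : borel_fun (fun _ : X => c).
Proof. by apply: continuous_borel_fun => x; exact: cvg_cst. Qed.

Lemma borel_funZD (k : C) (f g : E -> C) : borel_fun f -> borel_fun g ->
  borel_fun (fun x => k * f x + g x).
Proof.
move=> bf bg; apply: (@borel_fun_pair _ _ f g (fun z => k * z.1 + z.2)) => //.
by move=> z; apply: cvgD; [apply: cvgM; [exact: cvg_cst|exact: cvg_fst]|exact: cvg_snd].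
Qed.

Lemma borel_funM (f g : E -> C) : borel_fun f -> borel_fun g ->
  borel_fun (fun x => f x * g x).
Proof.
move=> bf bg; apply: (@borel_fun_pair _ _ f g (fun z => z.1 * z.2)) => //.
by move=> z; apply: cvgM; [exact: cvg_fst|exact: cvg_snd].
Qed.

Lemma set1_borelC (z : C) : borel_sets [set z].
Proof.
have [s0 sD sU] := smallest_sigma_algebra setT (@open C).
rewrite -[[set z]]setCK -setTD; apply: sD; apply: sub_gen_smallest.
by rewrite openC; apply: accessible_closed_set1; apply: hausdorff_accessible; exact: norm_hausdorff.
Qed.

(** The inverse is continuous off [0] and [0^-1 = 0], so the preimage of an open
    set is an open set together with at most the point [0]. *)
Lemma borel_inv : borel_fun (GRing.inv : C -> C).
Proof.
have [s0 sD sU] := smallest_sigma_algebra setT (@open C).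
have bD (B : set C) : borel_sets B -> borel_sets (~` B) by rewrite -setTD; exact: sD.
apply: (@borel_fun_open C C) => U oU.
have oV : open ((@GRing.inv C) @^-1` U `&` ~` [set 0]).
  rewrite openE => z [Uz /eqP z0]; apply: filterI.
    by apply: (inv_continuous z0); exact: open_nbhs_nbhs.
  apply: open_nbhs_nbhs; split; last exact/eqP.
  by rewrite openC; apply: accessible_closed_set1; apply: hausdorff_accessible; exact: norm_hausdorff.
rewrite (_ : _ @^-1` U = ~` (~` ((@GRing.inv C) @^-1` U `&` ~` [set 0]) `&`
    ~` (if `[< U 0 >] then [set 0] else set0))).
  apply: (bD); apply: borel_setI; apply: bD; first exact: sub_gen_smallest.
  by case: asboolP => _; [exact: set1_borelC|exact: s0].
rewrite setCI !setCK; apply/seteqP; split => z /=.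
  have [->|/eqP z0] := eqVneq z 0; last by left.
  by rewrite invr0 => U0; right; rewrite asboolT.
by move=> [[]//|]; case: asboolP => //= U0 ->; rewrite invr0.
Qed.

(** The bounded Borel functions form one of the algebras over which the ray
    algebra is an intersection, so every element of the latter is bounded and
    Borel. *)
Lemma Linfty_cstar : unital_cstar_subalgebra mu (Linfty mu).
Proof.
split => //.
- split.
    split; first exact: borel_cst.
    by exists 1; apply: aeW => x; rewrite /cst normr1.
  split => [|k f g].
    apply/mem_set; split; first exact: borel_cst.
    by exists 0; apply: aeW => x; rewrite normr0.
  move=> /set_mem[bf [M fM]] /set_mem[bg [N gN]]; apply/mem_set.
  split; first exact: borel_funZD.
  exists (`|k| * M + N); apply: filterS2 fM gN => x fM gN.
  by apply: le_trans (ler_normD _ _) _; rewrite lerD// normrM ler_wpM2l.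
- move=> f g [bf [M fM]] [bg [N gN]]; split; first exact: borel_funM.
  exists (M * N); apply: filterS2 fM gN => x fM gN.
  by rewrite normrM ler_pM.
- move=> f [bf [M fM]]; split.
    by apply: (borel_fun_comp bf); apply: continuous_borel_fun; exact: conj_continuous.
  by exists M; apply: filterS fM => x; rewrite norm_conjC.
Qed.

Lemma ray_Linfty t : Linfty mu (ray t).
Proof.
have [s0 sD sU] := smallest_sigma_algebra setT (@open E).
split; last first.
  by exists 1; apply: aeW => x; rewrite /ray_indicator normr_nat lern1 leq_b1.
move=> B _; have bU : borel_sets [set x : E | t <o x].
  by apply: sub_gen_smallest; exact: open_rray.
have bT : borel_sets [set: E] by apply: sub_gen_smallest; exact: openT.
have bC : borel_sets (~` [set x : E | t <o x]) by rewrite -setTD; exact: sD.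
have [B1|nB1] := pselect (B 1); have [B0|nB0] := pselect (B 0).
- rewrite (_ : _ @^-1` _ = setT) //; apply/seteqP; split => // x _ /=.
  by rewrite /ray_indicator; case: ltP.
- rewrite (_ : _ @^-1` _ = [set x : E | t <o x]) //; apply/seteqP; split => x /=.
    by rewrite /ray_indicator; case: ltP.
  by rewrite /ray_indicator => ->.
- rewrite (_ : _ @^-1` _ = ~` [set x : E | t <o x]) //; apply/seteqP; split => x /=.
    by rewrite /ray_indicator; case: ltP.
  by rewrite /ray_indicator => /negP/negbTE ->.
- rewrite (_ : _ @^-1` _ = set0) //; apply/seteqP; split => // x /=.
  by rewrite /ray_indicator; case: ltP.
Qed.

Lemma A_ray t : A (ray t). Proof. by move=> B _; apply. Qed.

Lemma A_Linfty : A `<=` Linfty mu.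
Proof. by move=> a; apply; [exact: Linfty_cstar|exact: ray_Linfty]. Qed.

Lemma A_1 : A (fun=> 1). Proof. by move=> B [_ [? _] _ _ _] _. Qed.

Lemma A_ZD k a b : A a -> A b -> A (fun x => k * a x + b x).
Proof.
move=> Aa Ab B HB rB; have [_ [_ [_ BD]] _ _ _] := HB.
by apply/set_mem/(BD k a b); apply/mem_set; [exact: Aa|exact: Ab].
Qed.

Lemma A_M a b : A a -> A b -> A (fun x => a x * b x).
Proof.
move=> Aa Ab B HB rB; have [_ _ BM _ _] := HB.
by apply: BM; [exact: Aa|exact: Ab].
Qed.

Lemma A_conj a : A a -> A (fun x => (a x)^*).
Proof. by move=> Aa B HB rB; have [_ _ _ BJ _] := HB; apply: BJ; exact: Aa. Qed.

Lemma A_lim a : Linfty mu a -> (forall e : C, 0 < e ->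
  exists2 g, A g & {ae mu, forall x, `|a x - g x| <= e}) -> A a.
Proof.
move=> La lima B HB rB; have [_ _ _ _ Blim] := HB; apply: Blim => // e e0.
by have [g Ag ?] := lima e e0; exists g => //; exact: Ag.
Qed.

Lemma A_ae a b : borel_fun a -> {ae mu, forall x, a x = b x} -> A b -> A a.
Proof.
move=> ba ab Ab; have [_ [M bM]] := A_Linfty Ab; apply: A_lim.
  by split => //; exists M; apply: filterS2 ab bM => x ->.
move=> e e0; exists b => //; apply: filterS ab => x ->.
by rewrite subrr normr0 ltW.
Qed.

Lemma A_0 : A (fun=> 0).
Proof.
by have := A_ZD (-1) A_1 A_1; under eq_fun do rewrite mulN1r addNr.
Qed.

(** Induction on the ray algebra: a property of its elements that is stable
    under the C*-operations and uniform limits and holds for rays defines a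
    C*-subalgebra containing the rays. *)
Lemma A_ind (P : (E -> C) -> Prop) :
  P (fun=> 1) -> (forall t, P (ray t)) ->
  (forall k a b, A a -> A b -> P a -> P b -> P (fun x => k * a x + b x)) ->
  (forall a b, A a -> A b -> P a -> P b -> P (fun x => a x * b x)) ->
  (forall a, A a -> P a -> P (fun x => (a x)^*)) ->
  (forall a, A a -> (forall e : C, 0 < e -> exists g,
     [/\ A g, P g & {ae mu, forall x, `|a x - g x| <= e}]) -> P a) ->
  forall a, A a -> P a.
Proof.
move=> P1 Pray PD PM PJ Plim a Aa.
suff : [set a | A a /\ P a] a by case.
apply: Aa; last by move=> t; split; [exact: A_ray|exact: Pray].
split.
- by move=> b [/A_Linfty].
- split; first by split; [exact: A_1|].
  split.
    apply/mem_set; split; first exact: A_0.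
    have := PD (-1) _ _ A_1 A_1 P1 P1.
    by under eq_fun do rewrite mulN1r addNr.
  move=> k b c /set_mem[Ab Pb] /set_mem[Ac Pc]; apply/mem_set.
  by split; [exact: A_ZD|exact: PD].
- by move=> b c [Ab Pb] [Ac Pc]; split; [exact: A_M|exact: PM].
- by move=> b [Ab Pb]; split; [exact: A_conj|exact: PJ].
- move=> b Lb limb.
  have Ab : A b.
    by apply: A_lim => // e e0; have [g [Ag _] ?] := limb e e0; exists g.
  split => //; apply: Plim => // e e0; have [g [Ag Pg] ?] := limb e e0.
  by exists g.
Qed.

End ray_algebra.

(** * Characters are contractive *)

Section characters.
Context {R : realType} {E : topologicalZmodType} {d : Order.disp_t}
  {ord : Order.Total d E} {H : separable_ordered_group ord}.
Context {mu : {measure set (borel_type E) -> \bar R}} {Hmu : haar_measure mu}.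
Local Notation C := (Cplx R).
Local Notation A := (ray_algebra ord mu).

(** A character as a function of bare functions on [E], so that values at
    sums and products are written without membership proofs. *)
Definition gel (chi : A -> C) (a : E -> C) : C :=
  if pselect (A a) is left Aa then chi (SigSub (mem_set Aa)) else 0.

Lemma gel_val (chi : A -> C) (a : A) : gel chi (val a) = chi a.
Proof.
rewrite /gel; case: pselect => [Aa|nAa]; last by case: nAa; exact: set_valP.
by congr chi; exact: val_inj.
Qed.

Lemma gelE (chi : A -> C) (a : E -> C) (Aa : A a) :
  gel chi a = chi (SigSub (mem_set Aa)).
Proof. by rewrite -gel_val. Qed.

Section character.
Variables (chi : A -> C) (Hchi : is_character chi).
Local Notation g := (gel chi).

Lemma gel_ae (k : C) a b c : A a -> A b -> A c ->
  {ae mu, forall x, c x = k * a x + b x} -> g c = k * g a + g b.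
Proof.
case: Hchi => _ lin _ Aa Ab Ac abc.
by rewrite !gelE; exact: lin.
Qed.

Lemma gelM_ae a b c : A a -> A b -> A c ->
  {ae mu, forall x, c x = a x * b x} -> g c = g a * g b.
Proof.
case: Hchi => _ _ mul Aa Ab Ac abc.
by rewrite !gelE; exact: mul.
Qed.

Lemma gelZD k a b : A a -> A b -> g (fun x => k * a x + b x) = k * g a + g b.
Proof. by move=> Aa Ab; apply: gel_ae => //; [exact: A_ZD|exact: aeW]. Qed.

Lemma gelM a b : A a -> A b -> g (fun x => a x * b x) = g a * g b.
Proof. by move=> Aa Ab; apply: gelM_ae => //; [exact: A_M|exact: aeW]. Qed.

Lemma gel0 : g (fun=> 0) = 0.
Proof.
have := gelZD 1 A_0 A_0; rewrite mulr0 addr0 => /eqP.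
by rewrite mul1r -subr_eq0 opprD addNKr oppr_eq0 => /eqP.
Qed.

Lemma gel1 : g (fun=> 1) = 1.
Proof.
case: (Hchi) => -[a chia _ _].
have Aa : A (val a) := set_valP a.
have := gelM A_1 Aa; under eq_fun do rewrite mul1r.
rewrite gel_val => /esym/eqP; rewrite -{2}[chi a]mul1r => /eqP/mulIf; apply.
exact/eqP.
Qed.

Lemma gelB a b : A a -> A b -> g (fun x => a x - b x) = g a - g b.
Proof.
move=> Aa Ab; rewrite (gel_ae (k := -1) Ab Aa); first by rewrite mulN1r addrC.
  by have := A_ZD (-1) Ab Aa; under eq_fun do rewrite mulN1r addrC.
by apply: aeW => x; rewrite mulN1r addrC.
Qed.

Lemma gel_eq_ae a b : A a -> A b -> {ae mu, forall x, a x = b x} -> g a = g b.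
Proof.
move=> Aa Ab ab; rewrite (gel_ae (k := 0) A_0 Ab Aa); first by rewrite mul0r add0r.
by apply: filterS ab => x ->; rewrite mul0r add0r.
Qed.

Lemma A_X a n : A a -> A (fun x => a x ^+ n).
Proof.
move=> Aa; elim: n => [|n IH]; first exact: A_1.
by under eq_fun do rewrite exprS; exact: A_M.
Qed.

Lemma A_geometric a n : A a -> A (fun x => \sum_(i < n) a x ^+ i).
Proof.
move=> Aa; elim: n => [|n IH].
  by under eq_fun do rewrite big_ord0; exact: A_0.
under eq_fun do rewrite big_ord_recr /= -[X in X + _]mul1r.
by apply: A_ZD => //; exact: A_X.
Qed.

Lemma geometric_small (q e : R) : 0 <= q -> q < 1 -> 0 < e ->
  exists n, q ^+ n / (1 - q) <= e.
Proof.
move=> q0 q1 e0.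
have q1' : 0 < 1 - q by rewrite subr_gt0.
have : `|q| < 1 by rewrite ger0_norm.
move=> /cvg_expr/cvgr0Pnorm_le/(_ (e * (1 - q)) (mulr_gt0 e0 q1'))[n _ /(_ n)].
move=> /(_ (leqnn n)) /=; rewrite normrX ger0_norm // => qn.
by exists n; rewrite ler_pdivrMr.
Qed.

(** If [|a| <= q < 1] then [1 - a] is invertible in the algebra: the geometric
    series converges uniformly off a null set. *)
Lemma neumann a (q : R) : q < 1 -> A a -> {ae mu, forall x, `|a x| <= q%:C%C} ->
  A (fun x => (1 - a x)^-1).
Proof.
move=> q1 Aa aq.
wlog q0 : q q1 aq / 0 <= q.
  move=> h; apply: (h (Num.max q 0)).
  - by rewrite gt_max q1 ltr01.
  - by apply: filterS aq => x /le_trans; apply; rewrite lecR le_max lexx.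
  - by rewrite le_max lexx orbT.
have q1' : 0 < 1 - q by rewrite subr_gt0.
have one_sub_ge x : `|a x| <= q%:C%C -> (1 - q)%:C%C <= `|1 - a x|.
  move=> ax; apply: le_trans (lerB_dist _ _); rewrite normr1 rmorphB /= rmorph1.
  by rewrite lerB.
have inv_le x : `|a x| <= q%:C%C -> `|(1 - a x)^-1| <= ((1 - q)^-1)%:C%C.
  move=> /one_sub_ge ax; rewrite normfV fmorphV lef_pV2 //; first 1 last.
  - by rewrite posrE ltcR.
  - by rewrite posrE; apply: lt_le_trans ax; rewrite ltcR.
have [ba _] := A_Linfty Aa.
apply: A_lim.
  split; last by exists ((1 - q)^-1)%:C%C; apply: filterS aq.
  apply: (@borel_fun_comp E C C (fun x => 1 - a x) (@GRing.inv C)); last exact: borel_inv.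
  have -> : (fun x => 1 - a x) = (fun x => (-1) * a x + 1).
    by apply/funext => x; rewrite mulN1r addrC.
  by apply: borel_funZD => //; exact: borel_cst.
move=> e /pos_real[r r0 ->].
have [n qn] := geometric_small q0 q1 r0.
exists (fun x => \sum_(i < n) a x ^+ i); first exact: A_geometric.
apply: filterS aq => x ax.
have ax1 : 1 - a x != 0.
  by rewrite -normr_gt0; apply: lt_le_trans (one_sub_ge x ax); rewrite ltcR.
have -> : (1 - a x)^-1 - \sum_(i < n) a x ^+ i = a x ^+ n * (1 - a x)^-1.
  have S : (\sum_(i < n) a x ^+ i) * (1 - a x) = 1 - a x ^+ n.
    by rewrite mulrC -[1 - a x]opprB mulNr -subrX1 opprB.
  by apply: (mulIf ax1); rewrite mulrBl S mulVf // -mulrA mulVf // mulr1 subKr.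
rewrite normrM; apply: le_trans (_ : (q ^+ n / (1 - q))%:C%C <= _); last by rewrite lecR.
rewrite rmorphM rmorphXn /= ler_pM // ?inv_le // normrX.
by rewrite lerXn2r // nnegrE ?lecR.
Qed.

(** If [|g a| > M] then [b = a / g a] has norm below [1] and [g b = 1], so
    [1 - b] is invertible and yet killed by [g]. *)
Lemma gel_contractive a (M : C) : A a -> {ae mu, forall x, `|a x| <= M} -> `|g a| <= M.
Proof.
move=> Aa aM.
have [m m0 Mm] : exists2 m : R, 0 <= m & M = m%:C%C.
  have [x ax] : exists x, `|a x| <= M.
    have PF : ProperFilter (nbhs (almost_everywhere mu)).
      apply: (@ae_properfilter_algebraOfSetsType _ (borel_type E)).
      by rewrite measure_gt0; case: Hmu.
    exact: filter_ex aM.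
  move: (le_trans (normr_ge0 _) ax); case: (M) => u v.
  by rewrite lecE /= => /andP[/eqP -> u0]; exists u.
rewrite real_leNgt ?normr_real ?Mm //; last by rewrite realE lecR m0.
have [l Ml] : exists l : R, `|g a| = l%:C%C by rewrite normc_def; eexists.
apply/negP; rewrite Ml ltcR => ml.
have l0 : 0 < l by exact: le_lt_trans ml.
have ga0 : g a != 0 by rewrite -normr_gt0 Ml ltcR.
pose b x := (g a)^-1 * a x + 0.
have Ab : A b by apply: A_ZD => //; exact: A_0.
have bq : {ae mu, forall x, `|b x| <= (m / l)%:C%C}.
  apply: filterS aM => x ax.
  rewrite /b addr0 normrM normfV Ml rmorphM /= fmorphV mulrC ler_wpM2r // -?Mm //.
  by rewrite invr_ge0 lecR ltW.
have q1 : m / l < 1 by rewrite ltr_pdivrMr // mul1r.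
have Af := neumann q1 Ab bq.
have A1b : A (fun x => 1 - b x).
  have := A_ZD (-1) Ab A_1.
  by under eq_fun do rewrite mulN1r addrC.
have := gelM_ae A1b Af A_1.
rewrite gel1 (gelB A_1 Ab) gel1 gelZD // ?gel0 ?addr0 ?mulVf // ?subrr ?mul0r; last exact: A_0.
move=> h; suff : (1 : C) = 0 by move/eqP; rewrite oner_eq0.
apply: h; apply: filterS bq => x bx; rewrite mulfV // subr_eq0; apply/negP => /eqP b1.
by move: bx; rewrite -b1 normr1 -(rmorph1 (real_complex R)) lecR leNgt q1.
Qed.

End character.
End characters.

(** * Characters are cuts *)

Lemma cvg_initial (S : choiceType) (T : topologicalType) (f : S -> T)
    (F : set_system S) (s : S) : Filter F ->
  f @ F --> f s -> F --> (s : initial_topology f).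
Proof.
move=> FF fF U [_ [[B oB <-] Bs sBU]]; apply: (filterS sBU).
by apply: fF; exact: open_nbhs_nbhs.
Qed.

Lemma cvg_ptws (I : Type) (T : topologicalType) (F : set_system (I -> T))
    (f : I -> T) : Filter F ->
  (forall i, g i @[g --> F] --> f i) -> F --> (f : {ptws I -> T}).
Proof. by move=> FF Ff; apply/cvg_sup => i; apply: cvg_initial; exact: Ff. Qed.

Section cut_characters.
Context {R : realType} {E : topologicalZmodType} {d : Order.disp_t}
  {ord : Order.Total d E} {H : separable_ordered_group ord}.
Context {mu : {measure set (borel_type E) -> \bar R}} {Hmu : haar_measure mu}.
Local Notation "x <o y" := ((x : with_order ord) < (y : with_order ord))%O
  (at level 70, y at next level).
Local Notation oitv := (open_interval ord).
Local Notation C := (Cplx R).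
Local Notation ray := (ray_indicator R ord).
Local Notation A := (ray_algebra ord mu).
Local Notation K := (character_space ord mu).

Section character.
Variables (chi : A -> C) (Hchi : is_character chi).
Local Notation g := (gel chi).

Lemma le_all_eps (a b : C) : (forall e : C, 0 < e -> `|a - b| <= e + e) -> a = b.
Proof.
move=> ab; apply/eqP; rewrite -subr_eq0 -normr_eq0; apply/negP => /negP ab0.
have p : 0 < `|a - b| by rewrite lt_def ab0 normr_ge0.
have p2 : 0 < `|a - b| / 2 by rewrite divr_gt0.
have := ab (`|a - b| / 2 / 2) (divr_gt0 p2 (ltr0Sn _ _)).
rewrite -splitr real_leNgt ?realE ?normr_ge0 ?(ltW p2) // => /negP; apply.
by rewrite gtr_pMr // invf_lt1 // ltr1n.
Qed.

Lemma gel_dist a b (e : C) : A a -> A b -> {ae mu, forall x, `|a x - b x| <= e} ->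
  `|g a - g b| <= e.
Proof.
move=> Aa Ab ab; rewrite -(gelB Hchi) //; apply: gel_contractive => //.
have := A_ZD (-1) Ab Aa; congr A; apply/funext => x.
by rewrite mulN1r addrC.
Qed.

Lemma gel_ray01 t : g (ray t) = 0 \/ g (ray t) = 1.
Proof.
have := gelM Hchi (A_ray (mu := mu) t) (A_ray t).
rewrite (_ : (fun x => _) = ray t); last first.
  by apply/funext => x; rewrite /ray_indicator; case: ltP => _; rewrite ?mulr0 ?mulr1.
move=> /eqP; rewrite -subr_eq0 -{1}[g _]mulr1 -mulrBr mulf_eq0 subr_eq0.
by case/orP => [/eqP|/eqP <-]; [left|right].
Qed.

(** Characters are real on the rays, which are idempotent; compatibility with
    conjugation passes to the generated algebra, limits included, because
    characters are contractive. *)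
Lemma gel_conj a : A a -> g (fun x => (a x)^*) = (g a)^*.
Proof.
move: a; apply: A_ind.
- by under eq_fun do rewrite rmorph1; rewrite gel1 // rmorph1.
- move=> t; rewrite (_ : (fun x => _) = ray t); last first.
    by apply/funext => x; rewrite /ray_indicator conjC_nat.
  by case: (gel_ray01 t) => ->; rewrite ?rmorph0 ?rmorph1.
- move=> k a b Aa Ab Pa Pb; under eq_fun do rewrite rmorphD rmorphM.
  by rewrite (gelZD Hchi _ (A_conj Aa) (A_conj Ab)) Pa Pb (gelZD Hchi) // rmorphD rmorphM.
- move=> a b Aa Ab Pa Pb; under eq_fun do rewrite rmorphM.
  by rewrite (gelM Hchi (A_conj Aa) (A_conj Ab)) Pa Pb (gelM Hchi) // rmorphM.
- by move=> a Aa Pa; rewrite Pa conjCK; congr g; apply/funext => x; rewrite conjCK.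
- move=> a Aa lima; apply: le_all_eps => e e0.
  have [b [Ab Pb ab]] := lima e e0.
  rewrite -(subrK (g (fun x => (b x)^*)) (g _)) -addrA.
  apply: le_trans (ler_normD _ _) _; rewrite lerD //.
    apply: gel_dist; [exact: A_conj|exact: A_conj|].
    by apply: filterS ab => x; rewrite -rmorphB norm_conjC.
  by rewrite Pb -rmorphB norm_conjC distrC; exact: gel_dist.
Qed.

End character.

Lemma character_val (theta : K) : is_character (val theta).
Proof. exact: (set_valP theta). Qed.

(** The Gelfand transform of [a], evaluated at [theta]. *)
Definition ev (theta : K) (a : E -> C) : C := gel (val theta) a.

Lemma ev1 theta : ev theta (fun=> 1) = 1.
Proof. exact: gel1 (character_val theta). Qed.

Lemma evZD theta k a b : A a -> A b ->
  ev theta (fun x => k * a x + b x) = k * ev theta a + ev theta b.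
Proof. exact: gelZD (character_val theta) k a b. Qed.

Lemma evM theta a b : A a -> A b ->
  ev theta (fun x => a x * b x) = ev theta a * ev theta b.
Proof. exact: gelM (character_val theta) a b. Qed.

Lemma ev_conj theta a : A a -> ev theta (fun x => (a x)^*) = (ev theta a)^*.
Proof. exact: gel_conj (character_val theta) a. Qed.

Lemma ev_dist theta a b (e : C) : A a -> A b ->
  {ae mu, forall x, `|a x - b x| <= e} -> `|ev theta a - ev theta b| <= e.
Proof. exact: gel_dist (character_val theta) a b e. Qed.

Definition cut_of (theta : K) : set E := [set t | ev theta (ray t) = 1].

Lemma ev_ray (theta : K) t : ev theta (ray t) = (t \in cut_of theta)%:R.
Proof.
have [e|e] : ev theta (ray t) = 0 \/ ev theta (ray t) = 1.
  exact: gel_ray01 (character_val theta) t.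
  by rewrite e memNset //= /cut_of /= e => /esym/eqP; rewrite oner_eq0.
by rewrite e mem_set.
Qed.

Lemma cut_down_closed (theta : K) : down_set ord (cut_of theta).
Proof.
move=> s t st; rewrite /cut_of /= => ct.
have := evM theta (A_ray s) (A_ray t).
rewrite (_ : (fun x => _) = ray t) ?ct ?mulr1 //.
apply/funext => x; rewrite /ray_indicator; case: (ltP (t : with_order ord)) => tx.
  by rewrite (le_lt_trans st tx) mulr1.
by rewrite mulr0.
Qed.

(** The rays generate the algebra and evaluations are uniform limits of
    polynomials in rays, so convergence of cuts at every point is convergence
    in the character space. *)
Lemma cvg_character_space (F : set_system K) (theta : K) : Filter F ->
  (forall t, \forall theta' \near F, cut_of theta' t <-> cut_of theta t) -> F --> theta.
Proof.
move=> FF Fcut.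
have Fray t : \forall theta' \near F,
    ev theta' (ray t) = ev theta (ray t).
  apply: filterS (Fcut t) => theta' e; rewrite !ev_ray; congr (_ %:R).
  by congr nat_of_bool; apply/idP/idP => /set_mem h; apply/mem_set/e.
apply: cvg_initial; apply: cvg_ptws => a.
rewrite -(gel_val (val theta) a) -/(ev _ _).
suff : forall b, A b -> ev theta' b @[theta' --> F] --> ev theta b.
  move=> /(_ (val a) (set_valP a)).
  have -> : (fun theta' : K => ev theta' (val a)) = (fun theta' => val theta' a).
    by apply/funext => theta'; exact: gel_val.
  exact.
apply: A_ind.
- have -> : (fun theta' : K => ev theta' (fun=> 1)) = fun=> 1.
    by apply/funext => theta'; exact: ev1.
  by rewrite ev1; exact: cvg_cst.
- move=> t; apply: cvg_near_cst; exact: Fray.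
- move=> k b c Ab Ac Pb Pc.
  have -> : (fun theta' : K => ev theta' (fun x => k * b x + c x)) =
      fun theta' => k * ev theta' b + ev theta' c.
    by apply/funext => theta'; exact: evZD.
  rewrite (evZD theta k Ab Ac).
  apply: cvgD; last exact: Pc.
  by apply: cvgM; [exact: cvg_cst|exact: Pb].
- move=> b c Ab Ac Pb Pc.
  have -> : (fun theta' : K => ev theta' (fun x => b x * c x)) =
      fun theta' => ev theta' b * ev theta' c.
    by apply/funext => theta'; exact: evM.
  by rewrite (evM theta Ab Ac); apply: cvgM; [exact: Pb|exact: Pc].
- move=> b Ab Pb.
  have -> : (fun theta' : K => ev theta' (fun x => (b x)^*)) =
      fun theta' => (ev theta' b)^*.
    by apply/funext => theta'; exact: ev_conj.
  rewrite (ev_conj theta Ab).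
  by apply: (cvg_comp _ _ Pb); exact: conj_continuous.
- move=> b Ab limb; apply/cvgC_distP => e e0.
  have e2 : 0 < e / 2 by rewrite divr_gt0.
  have e4 : 0 < e / 2 / 2 by rewrite divr_gt0.
  have [c [Ac Pc bc]] := limb _ e4.
  apply: filterS ((cvgC_distP _ _ _).1 Pc _ e2) => theta' /= cc.
  have -> : ev theta b - ev theta' b = (ev theta b - ev theta c) +
      (ev theta' c - ev theta' b) + (ev theta c - ev theta' c).
    by ring.
  apply: le_lt_trans (ler_normD _ _) _; rewrite [ltRHS]splitr ler_ltD //.
  apply: le_trans (ler_normD _ _) _; rewrite [leRHS]splitr lerD //.
    exact: ev_dist.
  by rewrite distrC; exact: ev_dist.
Qed.

(** Finitely many points are separated by a cut [D] into those of [D] and those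
    above; a whole open interval lies between the two groups. Hence finite
    intersections of conditions [t < x], for [t] in [D], and [x <= t], for [t]
    not in [D], are never null. *)
Lemma interval_in_cell (D : set E) (l : seq E) : down_set ord D ->
  exists a b : E, a <o b /\
    forall x t, oitv a b x -> t \in l -> (t <o x) <-> D t.
Proof.
move=> dD.
have below (L : seq E) : exists a : E, forall t, t \in L -> a <o t.
  elim: L => [|t L [a aL]]; first by exists 0.
  have [a' a't] := exists_lt t; case: (leP (a : with_order ord) a') => aa.
    exists a => u; rewrite inE => /orP[/eqP ->|/aL //].
    exact: le_lt_trans aa a't.
  exists a' => u; rewrite inE => /orP[/eqP -> //|/aL].
  exact: lt_trans aa.
have above (L : seq E) : exists a : E, forall t, t \in L -> t <o a.
  have [a aL] := below [seq - t | t <- L]; exists (- a) => t tL.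
  by rewrite -[t]opprK olt_opp; apply: aL; exact: map_f.
have [a0 a0l] := below l; have [b0 b0l] := above (a0 :: l).
suff : forall l' : seq E, {subset l' <= l} -> exists a b : E, [/\ a <o b,
     D a \/ (forall t, t \in l -> a <o t), ~ D b \/ (forall t, t \in l -> t <o b) &
    forall x t, oitv a b x -> t \in l' -> (t <o x) <-> D t].
  move=> /(_ l (fun _ => id))[a [b [ab _ _ h]]]; by exists a, b.
elim=> [_|t l' IH l'l].
  exists a0, b0; split => //; first exact/b0l/mem_head.
  - by right.
  - by right => t tl; apply: b0l; rewrite inE tl orbT.
have [u ul'|a [b [ab Da Db h]]] := IH; first by apply: l'l; rewrite inE ul' orbT.
have tl : t \in l by apply: l'l; exact: mem_head.
have [Dt|nDt] := pselect (D t).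
- have tb : t <o b.
    case: Db => [nDb|]; last exact.
    by rewrite ltNge; apply/negP => /dD /(_ Dt).
  case: (leP (t : with_order ord) a) => ta.
    exists a, b; split => // x u xI; rewrite inE => /orP[/eqP ->|]; last exact: h.
    by split => // _; apply: le_lt_trans ta _; case: xI.
  exists t, b; split => //; first by left.
  move=> x u [tx xb]; rewrite inE => /orP[/eqP ->//|]; apply: h.
  by split => //; exact: lt_trans tx.
- have a_t : a <o t.
    case: Da => [Da|]; last exact.
    by rewrite ltNge; apply/negP => /dD /(_ Da).
  case: (leP (b : with_order ord) t) => bt.
    exists a, b; split => // x u xI; rewrite inE => /orP[/eqP ->|]; last exact: h.
    split => // tx; case: xI => _ xb.
    by have := lt_trans (lt_le_trans xb bt) tx; rewrite ltxx.
  exists a, t; split => //; first by left.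
  move=> x u [ax xt]; rewrite inE => /orP[/eqP ->|].
    by split => // tx; have := lt_trans tx xt; rewrite ltxx.
  by apply: h; split => //; exact: lt_trans bt.
Qed.

(** Limits along an ultrafilter of conull sets only see classes modulo null
    sets. *)
Lemma ultra_character (F : set_system E) : UltraFilter F ->
  (forall S, mu.-negligible (~` S) -> F S) ->
  is_character (fun a : A => lim (val a x @[x --> F])).
Proof.
move=> FU Fae.
have FP : ProperFilter F := ultra_proper.
have Fcvg (a : A) : cvg (val a x @[x --> F]).
  have [_ [M aM]] := A_Linfty (set_valP a).
  have [z az] := bounded_ultra_cvg FU (Fae _ aM).
  by apply/cvg_ex; exists z.
have ae_lim (f h : E -> C) z : {ae mu, forall x, f x = h x} -> h @ F --> z ->
    lim (f x @[x --> F]) = z.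
  move=> fh hz; apply/cvg_lim; first exact: norm_hausdorff.
  apply: cvg_trans hz; apply: near_eq_cvg; apply: Fae.
  by apply: negligibleS fh => x /= + e; apply.
split.
- exists (SigSub (mem_set A_1)) => /=; rewrite lim_cst; last exact: norm_hausdorff.
  by apply/eqP; rewrite oner_eq0.
- move=> k a b c abc; apply: (ae_lim _ (fun x => k * val a x + val b x)) => //.
  by apply: cvgD; [apply: cvgM; [exact: cvg_cst|exact: Fcvg]|exact: Fcvg].
- move=> a b c abc; apply: (ae_lim _ (fun x => val a x * val b x)) => //.
  by apply: cvgM; exact: Fcvg.
Qed.

(** The cells of [D] modulo null sets form a proper filter since Haar measure
    charges every nonempty interval; an ultrafilter above it converges to [D]. *)
Lemma character_of_cut (D : set E) : down_set ord D ->
  exists theta : K, cut_of theta = D.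
Proof.
move=> dD.
pose cell (l : seq E) : set E := [set x | forall t, t \in l -> (t <o x) <-> D t].
pose G : set_system E := [set S | exists l, {ae mu, forall x, cell l x -> S x}].
have GP : ProperFilter G.
  split.
    move=> [l h]; have [a [b [ab abI]]] := interval_in_cell l dD.
    have [u uI] := odense ab.
    have /eqP m_ab : mu (oitv a b) != 0%E.
      by apply: mu_open_pos; [exact: open_oitv|exists u].
    apply: m_ab; apply: measure_negligible.
      by apply: open_borel; exact: open_oitv.
    apply: negligibleS h => x xI /= h; apply: h => t tl; exact: abI tl.
  split.
  - by exists [::]; apply: aeW.
  - move=> S S' [l lS] [l' lS']; exists (l ++ l').
    apply: filterS2 lS lS' => x h h' c; split; [apply: h|apply: h'] => t tl; apply: c.
      by rewrite mem_cat tl.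
    by rewrite mem_cat tl orbT.
  - by move=> S S' SS' [l lS]; exists l; apply: filterS lS => x h /h; exact: SS'.
have [F [FU GF]] := ultraFilterLemma GP.
have FP : ProperFilter F := ultra_proper.
have Fae S : mu.-negligible (~` S) -> F S.
  move=> nS; apply: GF; exists [::]; apply: negligibleS nS => x /= + Sx; apply; by [].
have Fch := ultra_character FU Fae.
exists (SigSub (mem_set Fch)); apply/seteqP.
have key t : lim (ray t x @[x --> F]) = (t \in D)%:R.
  apply/cvg_lim; first exact: norm_hausdorff.
  apply: cvg_near_cst; apply: GF; exists [:: t]; apply: aeW => x /(_ t (mem_head _ _)) e.
  rewrite /= /ray_indicator; congr (_ %:R); congr nat_of_bool.
  by apply/idP/idP => [/e/mem_set|/set_mem/e].
split => t /=; rewrite /cut_of /= /ev (gelE _ (A_ray t)) /= key.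
  by case: (boolP (t \in D)) => [/set_mem//|_ /eqP]; rewrite eq_sym oner_eq0.
by move=> Dt; rewrite mem_set.
Qed.

End cut_characters.

(** * Ray functions and the reflection of the character space *)

Section character_space.
Context {R : realType} {E : topologicalZmodType} {d : Order.disp_t}
  {ord : Order.Total d E} {H : separable_ordered_group ord}.
Context {mu : {measure set (borel_type E) -> \bar R}} {Hmu : haar_measure mu}.
Local Notation "x <o y" := ((x : with_order ord) < (y : with_order ord))%O
  (at level 70, y at next level).
Local Notation "x <=o y" := ((x : with_order ord) <= (y : with_order ord))%O
  (at level 70, y at next level).
Local Notation C := (Cplx R).
Local Notation A := (ray_algebra ord mu).
Local Notation K := (character_space ord mu).
Local Notation CK := (CK ord mu).

Lemma ev_continuous a : A a -> continuous (fun theta : K => ev theta a).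
Proof.
move=> Aa.
have -> : (fun theta : K => ev theta a) =
    (fun theta => (val theta : {ptws A -> C}) (SigSub (mem_set Aa))).
  by apply/funext => theta; rewrite /ev gelE.
move=> theta; apply: (@continuous_comp _ _ _ (val : K -> {ptws A -> C})
  (fun f : {ptws A -> C} => f (SigSub (mem_set Aa)))).
  exact: initial_continuous.
exact: (@proj_continuous A (fun _ => C)).
Qed.

Lemma near_cut (theta : K) t : \forall theta' \near theta, cut_of theta' t <-> cut_of theta t.
Proof.
have /cvgrPdist_lt/(_ 1 ltr01) := @ev_continuous _ (A_ray t) theta.
apply: filterS => theta'; rewrite !ev_ray => h.
have : (t \in cut_of theta) = (t \in cut_of theta').
  move: h; case: (t \in cut_of theta); case: (t \in cut_of theta') => //=.
    by rewrite subr0 normr1 ltxx.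
  by rewrite sub0r normrN normr1 ltxx.
by move=> e; split=> /mem_set ct; apply/set_mem; [rewrite e|rewrite -e].
Qed.

(** The constant filter at [theta'] converges to [theta] as soon as both have
    the same cut. *)
Lemma cut_inj : injective (@cut_of R E d ord mu).
Proof.
move=> theta theta' e; apply: val_inj; apply/funext => a.
rewrite -!gel_val -!/(ev _ _).
have Fc : globally [set theta'] --> theta.
  by apply: cvg_character_space => t _ ->; rewrite e.
have Aa : A (val a) := set_valP a.
have l1 : ev x (val a) @[x --> globally [set theta']] --> ev theta (val a).
  exact: (cvg_comp _ _ Fc (@ev_continuous _ Aa theta)).
have l2 : ev x (val a) @[x --> globally [set theta']] --> ev theta' (val a).
  by apply: cvg_near_cst => x ->.
apply: (cvgC_unique _ l1 l2).
exact: globally_properfilter.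
Qed.

Lemma check_down (theta : K) : down_set ord [set t | ~ cut_of theta (- t)].
Proof.
move=> s t st nt cs; apply: nt; apply: cut_down_closed cs.
by rewrite ole_opp.
Qed.

(** The map of the character space induced by [x |-> - x]. It is defined on
    cuts, where the reflection exchanges a cut with the reflected complement:
    [x > t] becomes [x < - t], which is the complement of [x > - t] up to a
    null set. *)
Definition check (theta : K) : K := sval (cid (character_of_cut (@check_down theta))).

Lemma cut_check theta t : cut_of (check theta) t <-> ~ cut_of theta (- t).
Proof. by rewrite /check; case: cid => x /= ->. Qed.

Lemma checkK : involutive check.
Proof.
move=> theta; apply: cut_inj; apply/seteqP; split => t.
  by move=> /cut_check h; apply: contrapT => nt; apply: h; apply/cut_check; rewrite opprK.
by move=> ct; apply/cut_check => /cut_check; rewrite opprK.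
Qed.

Lemma check_continuous : continuous check.
Proof.
move=> theta; apply: cvg_character_space => [|t]; first
  exact: (fmap_filter _ (nbhs_filter theta)).
have := near_cut theta (- t); apply: filterS => theta' e.
by split=> /cut_check h; apply/cut_check => h'; apply: h; apply/e.
Qed.

Lemma le_down (t : E) : down_set ord [set s | s <=o t].
Proof. by move=> s u /le_trans h /h. Qed.

(** The character of limits from the right at [t]. *)
Definition right_char (t : E) : K := sval (cid (character_of_cut (@le_down t))).

Lemma cut_right t : cut_of (right_char t) = [set s | s <=o t].
Proof. by rewrite /right_char; case: cid. Qed.

Definition rayF (t : E) : CK := mkcts (@ev_continuous _ (A_ray t)).

Lemma rayFE t theta : rayF t theta = (t \in cut_of theta)%:R.
Proof. exact: ev_ray. Qed.

Lemma rayF_right t s : rayF t (right_char s) = (t <=o s)%:R.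
Proof.
rewrite rayFE cut_right; congr (_ %:R); congr nat_of_bool.
by apply/idP/idP => [/set_mem|/mem_set].
Qed.

Lemma rayF_check t theta : rayF t (check theta) = 1 - rayF (- t) theta.
Proof.
rewrite !rayFE; have [/set_mem h|/negP h] := boolP (t \in cut_of (check theta)).
  by rewrite memNset ?subr0 //; exact/cut_check.
have -> : (- t \in cut_of theta) = true; last by rewrite subrr.
by apply/mem_set; apply: contrapT => nt; apply: h; apply/mem_set/cut_check.
Qed.

(** One half of the double arrow space, with an end point: it meets every
    orbit of the reflection. *)
Definition right_characters : set K :=
  [set theta | (exists t, cut_of theta = [set s | s <=o t]) \/ cut_of theta = setT].

Lemma right_or_check theta : right_characters theta \/ right_characters (check theta).
Proof.
have [C0|/eqP/set0P C0] := pselect (cut_of theta = set0).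
  right; right; apply/seteqP; split => // t _; apply/cut_check.
  by rewrite C0.
have [CT|/eqP CT] := pselect (cut_of theta = setT); first by left; right.
have [] := cut_max_or_min (cut_down_closed (theta := theta)) C0 CT.
  by move=> ?; left; left.
move=> [t ct]; right; left; exists (- t); apply/seteqP; split => s.
  move=> /cut_check; rewrite ct /= => /negP; rewrite -leNgt => h.
  by rewrite -ole_opp opprK.
move=> h; apply/cut_check; rewrite ct /= => st.
by move: st; rewrite ltNge -ole_opp opprK h.
Qed.

(** A basic neighbourhood prescribes the position of finitely many points with
    respect to the cut, and the interval between the two groups provides a
    right character. *)
Lemma right_dense (theta : K) (U : set K) : nbhs theta U -> exists s, U (right_char s).
Proof.
pose G : set_system K := [set V | exists l : seq E,
  forall s, (forall t, t \in l -> (t <=o s) <-> cut_of theta t) -> V (right_char s)].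
have FG : Filter G.
  split.
  - by exists [::].
  - move=> V W [l lV] [l' lW]; exists (l ++ l') => s h; split.
      by apply: lV => t tl; apply: h; rewrite mem_cat tl.
    by apply: lW => t tl; apply: h; rewrite mem_cat tl orbT.
  - by move=> V W VW [l lV]; exists l => s /lV; exact: VW.
have : G --> theta.
  apply: cvg_character_space => t; exists [:: t] => s /(_ t (mem_head _ _)).
  by rewrite cut_right.
move=> + Uth => /(_ _ Uth)[l lU].
have [a [b [ab abl]]] := interval_in_cell l (cut_down_closed (theta := theta)).
have [v [vI _] vl] := dense_avoid l denseT ab.
exists v; apply: lU => t tl; rewrite -(abl v t vI tl) le_eqVlt.
have -> // : ((t : with_order ord) == v) = false.
by apply/eqP => tv; rewrite -tv tl in vl.
Qed.

End character_space.

(** * The two topologies and the even-odd decomposition *)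

Section general_topologies.

Lemma finer_cvg (T : Type) (tau sigma : Topological T) :
  (forall (F : set_system T) (x : T), Filter F ->
    F --> (x : with_topology tau) -> F --> (x : with_topology sigma)) ->
  finer tau sigma.
Proof.
move=> h U; rewrite !openE => oU x Ux.
exact: (h _ x (nbhs_filter (x : with_topology tau)) cvg_id) (oU x Ux).
Qed.

Lemma same_on_cvg (T : choiceType) (tau sigma : Topological T) (Y : set T) :
  (forall (F : set_system T) (x : T), Y x -> F Y -> Filter F ->
    F --> (x : with_topology tau) -> F --> (x : with_topology sigma)) ->
  (forall (F : set_system T) (x : T), Y x -> F Y -> Filter F ->
    F --> (x : with_topology sigma) -> F --> (x : with_topology tau)) ->
  same_on tau sigma Y.
Proof.
have key (t1 t2 : Topological T) : (forall (F : set_system T) (x : T), Y x -> F Y ->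
    Filter F -> F --> (x : with_topology t1) -> F --> (x : with_topology t2)) ->
    @open (@subspace_type (with_topology t2) Y) `<=`
    @open (@subspace_type (with_topology t1) Y).
  move=> h U; rewrite !openE => oU x Ux.
  have N := nbhs_filter (x : @subspace_type (with_topology t1) Y).
  have cx : nbhs (x : @subspace_type (with_topology t1) Y) -->
      (x : @subspace_type (with_topology t2) Y).
    apply: cvg_initial; apply: (h _ (val x) (set_valP x)).
    - suff : nbhs x [set y : Y | Y (val y)] by [].
      by apply: filterE => y; exact: (set_valP y).
    - exact: (@initial_continuous Y (with_topology t1) val x).
  exact: cx (oU x Ux).
by move=> h1 h2; apply/seteqP; split; [exact: (key _ _ h2)|exact: (key _ _ h1)].
Qed.

End general_topologies.

Section function_space.
Context {R : realType} {E : topologicalZmodType} {d : Order.disp_t}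
  {ord : Order.Total d E} {H : separable_ordered_group ord}.
Context {mu : {measure set (borel_type E) -> \bar R}} {Hmu : haar_measure mu}.
Local Notation C := (Cplx R).
Local Notation K := (character_space ord mu).
Local Notation CK := (CK ord mu).

Lemma CK_zeroE theta : (0 : CK) theta = 0. Proof. by []. Qed.
Lemma CK_addE (f g : CK) theta : (f + g) theta = f theta + g theta. Proof. by []. Qed.
Lemma CK_oppE (f : CK) theta : (- f) theta = - f theta. Proof. by []. Qed.
Lemma CK_mulE (f g : CK) theta : (f * g) theta = f theta * g theta. Proof. by []. Qed.
Lemma CK_scaleE (k : C) (f : CK) theta : (k *: f) theta = k * f theta. Proof. by []. Qed.

Lemma CK_ext (f g : CK) : (forall theta, f theta = g theta) -> f = g.
Proof. by move=> fg; apply: val_inj; apply/funext. Qed.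

(** Both [tau_p] and the coarser topology are of this form. *)
Definition pointwise_on (S : choiceType) (i : S -> K) : Topological CK :=
  Topological.class (initial_topology
    (fun g : CK => (fun s => g (i s)) : {ptws S -> C})).

Lemma pointwise_eval_continuous (S : choiceType) (i : S -> K) (s : S) :
  continuous (fun g : with_topology (pointwise_on i) => (g : CK) (i s)).
Proof.
move=> g; apply: (@continuous_comp _ _ _ (fun g : with_topology (pointwise_on i) =>
   (fun s => (g : CK) (i s)) : {ptws S -> C}) (fun f : {ptws S -> C} => f s)).
  exact: initial_continuous.
exact: (@proj_continuous S (fun _ => C)).
Qed.

Lemma cvg_pointwise (S : choiceType) (i : S -> K) (F : set_system CK) (g : CK) :
  Filter F ->
  F --> (g : with_topology (pointwise_on i)) <->
  forall s, (h : CK) (i s) @[h --> F] --> g (i s).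
Proof.
move=> FF; split => [Fg s U /pointwise_eval_continuous|Fg]; first exact: Fg.
by apply: cvg_initial; apply: cvg_ptws => s; exact: Fg.
Qed.

(** Forgetting the left characters loses no information on even and odd
    functions, but the two halves of a general function become independent. *)
Definition tau' : Topological CK := pointwise_on (val : right_characters -> K).

Lemma finer_tau_p_cvg (F : set_system CK) (g : CK) : Filter F ->
  F --> (g : with_topology (tau_p K C)) -> F --> (g : with_topology tau').
Proof.
move=> FF /(cvg_pointwise id) Fg.
by apply/(cvg_pointwise val) => s; exact: Fg.
Qed.

Lemma finer_tau_p : finer (tau_p K C) tau'.
Proof.
by apply: finer_cvg => F g FF; exact: finer_tau_p_cvg.
Qed.

Lemma right_charP s : right_characters (right_char (mu := mu) s).
Proof. by left; exists s; exact: cut_right. Qed.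

(** Density of the right characters; this is why [tau'] is Hausdorff. *)
Lemma right_ext (f g : CK) :
  (forall theta, right_characters theta -> f theta = g theta) -> f = g.
Proof.
move=> fg; apply: CK_ext => theta.
pose F := within [set theta' : K | right_characters theta'] (nbhs theta).
have F0 : Filter F by apply: within_filter; exact: nbhs_filter.
have FF : ProperFilter F.
  apply: Build_ProperFilter_ex.
  move=> P /right_dense[s Ps].
  by exists (right_char s); apply: Ps; exact: right_charP.
have fF (h : CK) : h @ F --> h theta.
  by apply: cvg_trans (@cts_fun _ _ h theta); apply: cvg_app; exact: cvg_within.
apply: (cvgC_unique FF (fF f)).
apply: cvg_trans (fF g); apply: near_eq_cvg.
suff : nbhs theta [set theta' : K | right_characters theta' -> g theta' = f theta'] by [].
by apply: filterE => theta' r; rewrite fg.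
Qed.

Lemma near_eval (S : choiceType) (i : S -> K) (s : S) (g : CK) (e : C) : 0 < e ->
  nbhs (g : with_topology (pointwise_on i)) [set h : CK | `|g (i s) - h (i s)| < e].
Proof.
move=> e0.
exact: ((cvgC_distP _ _ (nbhs_filter (g : with_topology (pointwise_on i)))).1
  (@pointwise_eval_continuous _ i s g) e e0).
Qed.

Lemma near_tau' theta (g : CK) (e : C) : right_characters theta -> 0 < e ->
  nbhs (g : with_topology tau') [set h : CK | `|g theta - h theta| < e].
Proof. move=> r; exact: (@near_eval _ val (SigSub (mem_set r) : right_characters)). Qed.

Lemma cvg_tau' (F : set_system CK) (g : CK) : Filter F ->
  F --> (g : with_topology tau') <->
  forall theta, right_characters theta -> (h : CK) theta @[h --> F] --> g theta.
Proof.
move=> FF; split => [Fg theta r|Fg].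
  exact: ((cvg_pointwise (val : right_characters -> K) g FF).1 Fg (SigSub (mem_set r))).
apply: (cvg_pointwise (val : right_characters -> K) g FF).2 => s.
exact: Fg (set_valP s).
Qed.

Lemma hausdorff_tau' : hausdorff_space (with_topology tau').
Proof.
move=> p q pq; apply: right_ext => theta r; apply: le_all_eps => e e0.
have [h [ph qh]] := pq _ _ (near_tau' p r e0) (near_tau' q r e0).
rewrite -(subrK (h theta) (p theta)) -addrA.
apply: le_trans (ler_normD _ _) _; rewrite lerD // ?[`|h theta - _|]distrC ltW //.
Qed.

Definition even_part : set CK := [set g | forall theta, g (check theta) = g theta].
Definition odd_part : set CK := [set g | forall theta, g (check theta) = - g theta].

Lemma even_cstar : cstar_subalgebra even_part.
Proof.
split.
- split.
    split => [|k f g]; first by apply/mem_set.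
    move=> /set_mem ef /set_mem eg; apply/mem_set => theta.
    by rewrite !CK_addE !CK_scaleE ef eg.
  move=> g limg theta; apply: le_all_eps => e e0.
  have [h eh gh] := limg e e0.
  rewrite -(subrK (h theta) (g (check theta))) -addrA.
  apply: le_trans (ler_normD _ _) _; rewrite -{1}eh lerD //.
  by rewrite distrC.
- by move=> f g ef eg theta; rewrite !CK_mulE ef eg.
- by move=> f g ef fg theta; rewrite !fg ef.
Qed.

Lemma odd_banach : banach_subspace odd_part.
Proof.
split.
  split => [|k f g]; first by apply/mem_set => theta; rewrite CK_zeroE oppr0.
  move=> /set_mem ef /set_mem eg; apply/mem_set => theta.
  by rewrite !CK_addE !CK_scaleE ef eg mulrN opprD.
move=> g limg theta; apply: le_all_eps => e e0.
have [h eh gh] := limg e e0.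
rewrite opprK -(subrK (h (check theta)) (g (check theta))) -addrA.
apply: le_trans (ler_normD _ _) _; rewrite lerD //.
by rewrite eh addrC.
Qed.

Lemma cts_check (g : CK) : continuous (g \o check).
Proof.
by move=> theta; apply: continuous_comp; [exact: check_continuous|exact: cts_fun].
Qed.

Definition checkf (g : CK) : CK := mkcts (@cts_check g).

Lemma checkfE g theta : checkf g theta = g (check theta). Proof. by []. Qed.

Definition evenP (g : CK) : CK := 2^-1 *: (g + checkf g).
Definition oddP (g : CK) : CK := 2^-1 *: (g - checkf g).

Lemma evenP_even g : even_part (evenP g).
Proof. by move=> theta; rewrite !CK_scaleE !CK_addE !checkfE checkK addrC. Qed.

Lemma oddP_odd g : odd_part (oddP g).
Proof.
move=> theta; rewrite !CK_scaleE !CK_addE !CK_oppE !checkfE checkK.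
by rewrite -mulrN opprB.
Qed.

Lemma even_odd_sum g : evenP g + oddP g = g.
Proof.
apply: CK_ext => theta; rewrite CK_addE !CK_scaleE !CK_addE CK_oppE.
by field.
Qed.

Lemma cvg_tau_p (F : set_system CK) (g : CK) : Filter F ->
  F --> (g : with_topology (tau_p K C)) <->
  forall theta, (h : CK) theta @[h --> F] --> g theta.
Proof. exact: (cvg_pointwise id). Qed.

Lemma eval_tau_p theta : continuous (fun g : with_topology (tau_p K C) => (g : CK) theta).
Proof. exact: (@pointwise_eval_continuous _ id theta). Qed.

Lemma near_tau_p theta (g : CK) (e : C) : 0 < e ->
  nbhs (g : with_topology (tau_p K C)) [set h : CK | `|g theta - h theta| < e].
Proof. exact: (@near_eval _ id theta). Qed.

Lemma closed_even : closed (even_part : set (with_topology (tau_p K C))).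
Proof.
move=> g clg theta; apply: le_all_eps => e e0.
have [h [eh [h1 h2]]] := clg _ (filterI (near_tau_p (check theta) g e0) (near_tau_p theta g e0)).
rewrite -(subrK (h theta) (g (check theta))) -addrA.
apply: le_trans (ler_normD _ _) _; rewrite -{1}eh lerD // ltW //.
by rewrite distrC.
Qed.

Lemma closed_odd : closed (odd_part : set (with_topology (tau_p K C))).
Proof.
move=> g clg theta; apply: le_all_eps => e e0.
have [h [eh [h1 h2]]] := clg _ (filterI (near_tau_p (check theta) g e0) (near_tau_p theta g e0)).
rewrite opprK -(subrK (h (check theta)) (g (check theta))) -addrA.
apply: le_trans (ler_normD _ _) _; rewrite lerD // ltW //.
by rewrite eh addrC.
Qed.

(** A character which is not on the right has its reflection on the right, and
    an even function takes the same value at both. *)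
Lemma same_even : same_on (tau_p K C) tau' even_part.
Proof.
apply: same_on_cvg => F g eg Fe FF; first by move=> Fg; exact: (finer_tau_p_cvg FF Fg).
move=> /cvg_tau' Fg; apply/cvg_tau_p => theta.
have [r|r] := right_or_check theta; first exact: Fg.
rewrite -eg; apply: cvg_trans (Fg _ r); apply: near_eq_cvg.
by apply: (@filterS _ F FF _ _ _ Fe) => h eh; exact: eh.
Qed.

Lemma same_odd : same_on (tau_p K C) tau' odd_part.
Proof.
apply: same_on_cvg => F g eg Fe FF; first by move=> Fg; exact: (finer_tau_p_cvg FF Fg).
move=> /cvg_tau' Fg; apply/cvg_tau_p => theta.
have [r|r] := right_or_check theta; first exact: Fg.
have -> : g theta = - g (check theta) by rewrite eg opprK.
have Fgc : (h : CK) (check theta) @[h --> F] --> g (check theta).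
  exact: Fg.
have : - (h : CK) (check theta) @[h --> F] --> - g (check theta) by exact: (@cvgN _ C).
apply: cvg_trans; apply: near_eq_cvg.
by apply: (@filterS _ F FF _ _ _ Fe) => h eh /=; rewrite eh opprK.
Qed.

Lemma eval_sub (Y : set CK) theta :
  continuous (fun y : @subspace_type (with_topology (tau_p K C)) Y => (val y : CK) theta).
Proof.
move=> y; apply: (@continuous_comp _ _ _
  (val : @subspace_type (with_topology (tau_p K C)) Y -> with_topology (tau_p K C))
  (fun g : with_topology (tau_p K C) => (g : CK) theta)).
  exact: initial_continuous.
exact: eval_tau_p.
Qed.

Lemma sub_continuous_tau_p (T : topologicalType) (Y : set CK)
    (f : T -> @subspace_type (with_topology (tau_p K C)) Y) :
  (forall theta, continuous (fun x => (val (f x) : CK) theta)) -> continuous f.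
Proof.
move=> cf x; apply: cvg_initial; apply/cvg_tau_p => theta.
exact: cf.
Qed.

Lemma direct_sum : topological_direct_sum (tau_p K C) even_part odd_part.
Proof.
pose T := with_topology (tau_p K C).
split.
  move=> y; apply/cvg_tau_p => theta; rewrite CK_addE.
  have c1 : continuous (fun y : (@subspace_type T even_part *
      @subspace_type T odd_part)%type => (val y.1 : CK) theta).
    move=> z; apply: (@continuous_comp _ _ _ fst
      (fun z : @subspace_type T even_part => (val z : CK) theta)).
      exact: cvg_fst.
    exact: eval_sub.
  have c2 : continuous (fun y : (@subspace_type T even_part *
      @subspace_type T odd_part)%type => (val y.2 : CK) theta).
    move=> z; apply: (@continuous_comp _ _ _ snd
      (fun z : @subspace_type T odd_part => (val z : CK) theta)).
      exact: cvg_snd.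
    exact: eval_sub.
  exact: (cvgD (c1 y) (c2 y)).
pose fe (g : T) : @subspace_type T even_part := SigSub (mem_set (evenP_even g)).
pose fo (g : T) : @subspace_type T odd_part := SigSub (mem_set (oddP_odd g)).
have ce : continuous fe.
  apply: sub_continuous_tau_p => theta.
  suff : continuous (fun g : T => 2^-1 * ((g : CK) theta + checkf g theta) : C).
    exact.
  move=> g; exact: (cvgM (cvg_cst _) (cvgD (@eval_tau_p theta g) (@eval_tau_p (check theta) g))).
have co : continuous fo.
  apply: sub_continuous_tau_p => theta.
  suff : continuous (fun g : T => 2^-1 * ((g : CK) theta - checkf g theta) : C).
    exact.
  move=> g; exact: (cvgM (cvg_cst _) (cvgB (@eval_tau_p theta g) (@eval_tau_p (check theta) g))).
exists (fun g : T => (fe g, fo g)); split.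
- by move=> g; exact: (cvg_pair (ce g) (co g)).
- move=> [y1 y2] /=; have e1 := set_valP y1; have e2 := set_valP y2.
  have ey : evenP (val y1 + val y2) = val y1.
    apply: CK_ext => theta; rewrite CK_scaleE CK_addE checkfE !CK_addE e1 e2.
    by field.
  have oy : oddP (val y1 + val y2) = val y2.
    apply: CK_ext => theta; rewrite CK_scaleE CK_addE CK_oppE checkfE !CK_addE e1 e2.
    by field.
  by congr pair; apply: val_inj.
- by move=> g; exact: even_odd_sum.
Qed.

(** The odd function which is [1] to the right of [0] and [-1] to the left; it
    is its own inverse, so multiplication by it exchanges the two summands. *)
Definition sign : CK := 2 *: rayF 0 - 1.

Lemma signE theta : sign theta = 2 * rayF 0 theta - 1.
Proof. by rewrite CK_addE CK_scaleE. Qed.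

Lemma sign_odd : odd_part sign.
Proof.
move=> theta; rewrite !signE rayF_check oppr0; move: (rayF 0 theta) => r. ring.
Qed.

Lemma sign_sqr theta : sign theta * sign theta = 1.
Proof.
rewrite signE rayFE; case: (_ \in _) => /=.
  by rewrite mulr1 -[2]/(1 + 1) addrK mulr1.
by rewrite mulr0 sub0r mulrNN mulr1.
Qed.

Lemma sign_even g : odd_part g -> even_part (sign * g).
Proof. by move=> og theta; rewrite !CK_mulE sign_odd og mulrNN. Qed.

Lemma sign_even_odd g : even_part g -> odd_part (sign * g).
Proof. by move=> eg theta; rewrite !CK_mulE sign_odd eg mulNr. Qed.

Lemma even_odd_isomorphic : tvs_isomorphic (tau_p K C) even_part odd_part.
Proof.
pose T := with_topology (tau_p K C).
pose f (y : @subspace_type T even_part) : @subspace_type T odd_part :=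
  SigSub (mem_set (sign_even_odd (set_valP y))).
pose g (y : @subspace_type T odd_part) : @subspace_type T even_part :=
  SigSub (mem_set (sign_even (set_valP y))).
have signK h : sign * (sign * h) = h.
  by apply: CK_ext => theta; rewrite !CK_mulE mulrA sign_sqr mul1r.
exists f.
  split.
    apply: sub_continuous_tau_p => theta.
    suff : continuous (fun y : @subspace_type T even_part =>
        sign theta * (val y : CK) theta : C) by [].
    by move=> y; exact: (cvgM (cvg_cst _) (@eval_sub _ theta y)).
  exists g; split.
  - apply: sub_continuous_tau_p => theta.
    suff : continuous (fun y : @subspace_type T odd_part =>
        sign theta * (val y : CK) theta : C) by [].
    by move=> y; exact: (cvgM (cvg_cst _) (@eval_sub _ theta y)).
  - by move=> y; apply: val_inj; exact: signK.
  - by move=> y; apply: val_inj; exact: signK.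
move=> a x y z e; apply: CK_ext => theta.
rewrite CK_addE CK_scaleE !CK_mulE e CK_addE CK_scaleE mulrDr.
by rewrite mulrCA.
Qed.

End function_space.

(** * The curve of ray functions is Borel *)

Section sorgenfrey.
Context {R : realType} {E : topologicalZmodType} {d : Order.disp_t}
  {ord : Order.Total d E} {H : separable_ordered_group ord}.
Context {mu : {measure set (borel_type E) -> \bar R}} {Hmu : haar_measure mu}.
Local Notation "x <o y" := ((x : with_order ord) < (y : with_order ord))%O
  (at level 70, y at next level).
Local Notation "x <=o y" := ((x : with_order ord) <= (y : with_order ord))%O
  (at level 70, y at next level).
Local Notation C := (Cplx R).
Local Notation CK := (CK ord mu).
Local Notation tau' := (@tau' R E d ord mu).

(** The open sets of the left half-open (Sorgenfrey) topology of the group. *)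
Definition left_open (Z : set E) := forall t, Z t ->
  exists2 s, s <o t & forall u, s <o u -> u <=o t -> Z u.

Lemma left_open_countable_boundary (Z : set E) : left_open Z -> countable (Z `\` Z°).
Proof.
move=> loZ; apply: (left_isolated_countable (ord := ord)) => t [Zt nZt].
have [s st sZ] := loZ t Zt; exists s => //; apply/seteqP; split => // u [[su ut] [_]].
apply; apply: filterS (open_nbhs_nbhs (conj (open_oitv s t) (conj su ut))) => v [sv vt].
by apply: sZ => //; exact: ltW.
Qed.

(** The half-open topology has more open sets but the same Borel sets as the
    order topology: a left-open set exceeds its interior by points isolated
    from the left. *)
Lemma left_open_borel (Z : set E) : left_open Z -> borel_sets Z.
Proof.
move=> loZ; have -> : Z = Z° `|` (Z `\` Z°).
  by rewrite setDUK //; exact: interior_subset.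
apply: (@measurableU _ (borel_type E)).
  by apply: open_borel; exact: open_interior.
by apply: countable_borel; exact: left_open_countable_boundary.
Qed.

(** At the right character of [m], the ray function of [u] takes the value
    [u <= m], a left-continuous function of [u]; this would fail at the left
    character, where the value is [u < m]. *)
Lemma rayF_left_continuous (U : set CK) (t : E) :
  nbhs (rayF t : with_topology tau') U ->
  exists2 s, s <o t & forall u, s <o u -> u <=o t -> U (rayF u).
Proof.
pose G : set_system CK := [set V | exists2 s, s <o t &
  forall u, s <o u -> u <=o t -> V (rayF u)].
have FG : Filter G.
  split.
  - by have [s st] := exists_lt t; exists s.
  - move=> V W [s st sV] [s' st' sW]; exists (Order.max (s : with_order ord) s').
      by rewrite gt_max st.
    by move=> u; rewrite gt_max => /andP[su su'] ut; split; [exact: sV|exact: sW].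
  - by move=> V W VW [s st sV]; exists s => // u su ut; apply/VW/sV.
suff : G --> (rayF t : with_topology tau') by exact.
apply/(cvg_pointwise val) => -[theta /= /set_mem r].
apply/cvgC_distP => e e0.
have [s st h] : exists2 s, s <o t & forall u, s <o u -> u <=o t ->
    (u \in cut_of theta) = (t \in cut_of theta).
  case: r => [[m cm]|cT]; last first.
    by have [s st] := exists_lt t; exists s => // u _ _; rewrite cT !in_setT.
  have [tm|mt] := leP (t : with_order ord) m.
    have [s st] := exists_lt t; exists s => // u _ ut.
    by rewrite cm !mem_set //=; exact: le_trans tm.
  exists m => // u m_u ut; rewrite cm !memNset //=; apply/negP; by rewrite -ltNge.
by exists s => // u su ut /=; rewrite !rayFE h // subrr normr0.
Qed.

Lemma rayF_borel : borel_fun (rayF : E -> with_topology tau').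
Proof.
apply: borel_fun_open => U oU; apply: left_open_borel => t Ut.
by apply: rayF_left_continuous; exact: (open_nbhs_nbhs (conj oU Ut)).
Qed.

Lemma rayF_opp_borel : borel_fun ((fun t => rayF (- t)) : E -> with_topology tau').
Proof.
apply: (@borel_fun_comp E E (with_topology tau') (fun t => - t) rayF).
  by apply: continuous_borel_fun; exact: opp_continuous.
exact: rayF_borel.
Qed.

(** Values of ray functions are [0] or [1], so approximations within [1/4]
    determine them. *)
Lemma bool_close (b b' : bool) (z w : C) : `|z - b%:R| < 4^-1 ->
  `|w - b'%:R| < 4^-1 -> `|z - w| < 4^-1 -> b = b'.
Proof.
move=> zb wb zw.
have : `|b%:R - b'%:R : C| < 1.
  have -> : b%:R - b'%:R = - (z - b%:R) + (w - b'%:R) + (z - w).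
    by rewrite opprB; ring.
  apply: le_lt_trans (ler_normD _ _) _.
  apply: le_lt_trans (lerD (ler_normD _ _) (lexx _)) _.
  rewrite normrN.
  apply: lt_trans (ltrD (ltrD zb wb) zw) _.
  have -> : 4^-1 + 4^-1 + 4^-1 = 3 / 4 :> C by field.
  by rewrite ltr_pdivrMr // mul1r ltr_nat.
case: b {zb} => /=; case: b' {wb} => //=.
  by rewrite subr0 normr1 ltxx.
by rewrite sub0r normrN normr1 ltxx.
Qed.

Lemma bool_close1 (b b' : bool) (z : C) : `|z - b%:R| < 4^-1 ->
  `|z - b'%:R| < 4^-1 -> b = b'.
Proof. by move=> zb zb'; apply: bool_close zb zb' _; rewrite subrr normr0 invr_gt0. Qed.

End sorgenfrey.

(** * Sums, projections and products that are not Borel *)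

Section non_borel.
Context {R : realType} {E : topologicalZmodType} {d : Order.disp_t}
  {ord : Order.Total d E} {H : separable_ordered_group ord}.
Context {mu : {measure set (borel_type E) -> \bar R}} {Hmu : haar_measure mu}.
Local Notation "x <o y" := ((x : with_order ord) < (y : with_order ord))%O
  (at level 70, y at next level).
Local Notation "x <=o y" := ((x : with_order ord) <= (y : with_order ord))%O
  (at level 70, y at next level).
Local Notation C := (Cplx R).
Local Notation K := (character_space ord mu).
Local Notation CK := (CK ord mu).
Local Notation tau' := (@tau' R E d ord mu).

(** The difference of two Borel curves which isolates every positive parameter:
    [t <= s] and [- t <= - s] are both decided by [tau']-continuous
    evaluations. *)
Definition diffF (t : E) : CK := rayF t - rayF (- t).

Lemma diffF_right t s :
  diffF t (right_char s) = (t <=o s)%:R - (- t <=o s)%:R.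
Proof. by rewrite CK_addE CK_oppE !rayF_right. Qed.

(** The open set of the [g] such that [k * g + l] is close to [0] at the right
    of [t] and to [-1] at the right of [- t]. The affine map [k * g + l] allows
    the same set to serve for [diffF] and for the even part of a ray. *)
Definition separator (k l : C) (t : E) : set CK := [set g |
  `|k * g (right_char t) + l| < 2^-1 /\ `|k * g (right_char (- t)) + l + 1| < 2^-1].

Lemma eval_right s :
  continuous (fun g : with_topology tau' => (g : CK) (right_char s)).
Proof.
exact: (pointwise_eval_continuous (i := val : right_characters -> K)
  (s := SigSub (mem_set (right_charP s)))).
Qed.

Lemma open_disk (e : C) : open [set z : C | `|z| < e].
Proof.
rewrite openE => z ze; apply/nbhs_ballP; exists (e - `|z|) => /=.
  by rewrite subr_gt0.
move=> w zw; have {}zw : `|z - w| < e - `|z| := zw.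
have -> : w = z - (z - w) by rewrite subKr.
by apply: le_lt_trans (ler_normB _ _) _; rewrite addrC -ltrBrDr.
Qed.

Lemma open_separator k l t : open (separator k l t : set (with_topology tau')).
Proof.
have ball_open (r : C) (s : E) : open ([set g : CK | `|k * g (right_char s) + r| < 2^-1]
    : set (with_topology tau')).
  have cf : continuous (fun g : with_topology tau' =>
      k * (g : CK) (right_char s) + r : C).
    by move=> g; exact: (cvgD (cvgM (cvg_cst _) (@eval_right s g)) (cvg_cst _)).
  exact: (open_comp (fun g _ => cf g) (open_disk (e := 2^-1))).
rewrite (_ : separator k l t = [set g : CK | `|k * g (right_char t) + l| < 2^-1] `&`
  [set g : CK | `|k * g (right_char (- t)) + (l + 1)| < 2^-1]).
  by apply: openI; exact: ball_open.
by apply/seteqP; split => g []; rewrite /separator /= addrA.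
Qed.

(** The condition at the right of [- t0] says that [- t0 < t] and [t0 <= t];
    then [- t <= t0], and the condition at the right of [t0], by which
    [t <= t0] and [- t <= t0] are equivalent, gives [t <= t0]. *)
Lemma separator_diffF k l (t t0 : E) (g : CK) : 0 <o t0 ->
  (forall theta, k * g theta + l = diffF t theta) ->
  separator k l t0 g <-> t = t0.
Proof.
move=> t0p gE; rewrite /separator /= !gE !diffF_right.
have n0 : - t0 <o t0.
  apply: (@lt_trans _ _ (0 : with_order ord)) (t0p).
  by rewrite -[X in _ <o X]oppr0 olt_opp.
have half_lt1 : 2^-1 < 1 :> C by rewrite invf_lt1 // ltr1n.
have diff_small (b b' : bool) : `|b%:R - b'%:R : C| < 2^-1 -> b = b'.
  move=> bb; have : `|b%:R - b'%:R : C| < 1 := lt_trans bb half_lt1.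
  case: b {bb}; case: b' => //=; first by rewrite subr0 normr1 ltxx.
  by rewrite sub0r normrN normr1 ltxx.
rewrite ole_opp; split => [[/diff_small h1 h2]|->]; last first.
  have e1 : (t0 <=o t0) = true by exact: lexx.
  have e2 : (- t0 <=o t0) = true by exact: ltW.
  have e3 : (t0 <=o - t0) = false by exact: lt_geF.
  by rewrite e1 e2 e3 subrr normr0 sub0r addNr normr0 invr_gt0.
have {h2} [] : (t <=o - t0) = false /\ (t0 <=o t) = true.
  move: h2; case: (t <=o - t0); case: (t0 <=o t) => // h2; exfalso; move: h2.
  - by rewrite subrr add0r normr1 (lt_gtF half_lt1).
  - rewrite subr0 -[1 + 1]/(2%:R) normr_nat.
    have h : 2^-1 < 2 :> C by apply: lt_trans half_lt1 _; rewrite ltr1n.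
    by rewrite (lt_gtF h).
  - by rewrite subrr add0r normr1 (lt_gtF half_lt1).
move=> _ t0t; have tp : - t <=o t0.
  by apply: ltW; apply: le_lt_trans n0; rewrite ole_opp.
by apply: (@le_anti _ (with_order ord)); rewrite t0t h1 tp.
Qed.

Lemma borel_rays_sub_nonlinear : exists2 V : set CK,
  open (V : set (with_topology tau')) & ~ borel_sets (diffF @^-1` V).
Proof.
have [c [V [c0 Vc nV]]] := non_borel_set (ord := ord) (mu := mu).
exists (\bigcup_(t in V) separator 1 0 t).
  by apply: bigcup_open => t _; exact: open_separator.
suff -> : diffF @^-1` (\bigcup_(t in V) separator 1 0 t) = V by [].
have sep (t t0 : E) : V t0 -> separator 1 0 t0 (diffF t) <-> t = t0.
  by move=> /Vc[t0p _]; apply: separator_diffF => // theta; rewrite mul1r addr0.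
apply/seteqP; split => [t [t0 Vt0 /sep -> //]|t Vt]; exists t => //.
by apply/sep.
Qed.

(** Both [t |-> rayF t] and [t |-> rayF (- t)] are Borel, but the preimages of
    open sets under their difference include a Vitali set. *)
Lemma borel_maps_not_linear : ~ submod_closed (mem [set H : E -> CK |
  borel_fun (H : E -> with_topology tau')]).
Proof.
move=> [_ lin]; have [V oV] := borel_rays_sub_nonlinear; apply.
pose u : E -> CK := fun t => rayF (- t).
pose v : E -> CK := fun t => rayF t.
have bu : u \in mem [set H : E -> CK | borel_fun (H : E -> with_topology tau')].
  by apply/mem_set; exact: rayF_opp_borel.
have bv : v \in mem [set H : E -> CK | borel_fun (H : E -> with_topology tau')].
  by apply/mem_set; exact: rayF_borel.
have /set_mem bd := lin (-1) u v bu bv.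
have -> : diffF = -1 *: u + v.
  by apply/funext => t; rewrite /diffF addrC -scaleN1r.
by apply: bd; exact: sub_gen_smallest.
Qed.

Definition even_proj (g : with_topology tau') :
  @subspace_type (with_topology tau') even_part := SigSub (mem_set (evenP_even g)).

(** The even part of [rayF t] is [(1 + diffF t) / 2]. As [t |-> rayF t] is
    Borel, a Borel projection would make the Vitali set Borel. *)
Lemma projection_not_borel :
  exists2 P : with_topology tau' -> @subspace_type (with_topology tau') even_part,
    forall g : CK, odd_part (g - val (P g)) & ~ borel_fun P.
Proof.
exists even_proj.
  move=> g /=; have {1}-> : g = evenP g + oddP g by rewrite even_odd_sum.
  by rewrite addrAC subrr add0r; exact: oddP_odd.
move=> bP.
have [c [V [c0 Vc nV]]] := non_borel_set (ord := ord) (mu := mu).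
apply: nV.
pose U : set CK := \bigcup_(t in V) separator 2 (-1) t.
have oU : open (U : set (with_topology tau')).
  by apply: bigcup_open => t _; exact: open_separator.
have {bP oU} := bP (val @^-1` U) (sub_gen_smallest (ex_intro2 _ _ U oU erefl)).
move=> /rayF_borel.
suff -> : rayF @^-1` (even_proj @^-1` (val @^-1` U)) = V by [].
have sep (t t0 : E) : V t0 -> separator 2 (-1) t0 (evenP (rayF t)) <-> t = t0.
  move=> /Vc[t0p _]; apply: separator_diffF => // theta.
  rewrite CK_scaleE !CK_addE CK_oppE checkfE rayF_check mulrA divff ?mul1r //.
  by rewrite [1 - _]addrC addrA addrK.
apply/seteqP; split => [t [t0 Vt0 /sep -> //]|t Vt]; exists t => //.
by apply/sep.
Qed.

Definition near_one (s : E) : set CK := [set g | `|1 - g (right_char s)| < 4^-1].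

Lemma open_near_one s : open (near_one s : set (with_topology tau')).
Proof.
have cf : continuous (fun g : with_topology tau' => 1 - (g : CK) (right_char s) : C).
  by move=> g; exact: (cvgB (cvg_cst _) (@eval_right s g)).
exact: (open_comp (fun g _ => cf g) (open_disk (e := 4^-1))).
Qed.

(** The curve [t |-> (rayF t, rayF (- t))] pulls the product sigma-algebra back
    to Borel sets, but it meets the open set [U t0] only at [t0]: the first
    component imposes [t <= t0] and the second [- t <= - t0]. *)
Lemma product_borel_neq :
  prod_sigma_algebra (borel_sets (X := with_topology tau'))
                     (borel_sets (X := with_topology tau')) <>
  borel_sets (X := (with_topology tau' * with_topology tau')%type).
Proof.
have [c [V [c0 Vc nV]]] := non_borel_set (ord := ord) (mu := mu).
pose T := with_topology tau'.
pose U (t : E) : set (T * T) := near_one t `*` near_one (- t).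
have oU t : open (U t).
  rewrite openE => -[g1 g2] [g1U g2U]; exists (near_one t, near_one (- t)) => //=.
  split.
    exact: (open_nbhs_nbhs (conj (@open_near_one t) g1U)).
  exact: (open_nbhs_nbhs (conj (@open_near_one (- t)) g2U)).
pose W := \bigcup_(t in V) U t.
have oW : open W by apply: bigcup_open => t _; exact: oU.
pose f (t : E) : T * T := (rayF t, rayF (- t)).
have close1 (b : bool) : `|1 - b%:R : C| < 4^-1 -> b = true.
  have h0 : `|b%:R - b%:R : C| < 4^-1 by rewrite subrr normr0 invr_gt0.
  by rewrite distrC => h; exact: (bool_close1 h0 (b' := true) h).
have fW : f @^-1` W = V.
  apply/seteqP; split => [t [t0 Vt0 [/=]]|t Vt].
    rewrite /near_one /= !rayF_right => /close1 h1 /close1; rewrite ole_opp => h2.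
    suff -> : t = t0 by [].
    by apply: (@le_anti _ (with_order ord)); rewrite h1 h2.
  exists t => //; rewrite /U /near_one /= !rayF_right.
  have e s : (s <=o s) = true by exact: lexx.
  by rewrite !e subrr normr0 invr_gt0.
move=> eqB; apply: nV; rewrite -fW.
have : prod_sigma_algebra (borel_sets (X := T)) (borel_sets (X := T)) W.
  by rewrite eqB; exact: sub_gen_smallest.
apply: (@borel_preimage_generated E) => _ [A bA [B bB <-]].
exact: (borel_setI (rayF_borel bA) (rayF_opp_borel bB)).
Qed.

End non_borel.

(** * Even steps form a closed discrete set *)

Section even_steps.
Context {R : realType} {E : topologicalZmodType} {d : Order.disp_t}
  {ord : Order.Total d E} {H : separable_ordered_group ord}.
Context {mu : {measure set (borel_type E) -> \bar R}} {Hmu : haar_measure mu}.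
Local Notation "x <o y" := ((x : with_order ord) < (y : with_order ord))%O
  (at level 70, y at next level).
Local Notation "x <=o y" := ((x : with_order ord) <= (y : with_order ord))%O
  (at level 70, y at next level).
Local Notation oitv := (open_interval ord).
Local Notation C := (Cplx R).
Local Notation K := (character_space ord mu).
Local Notation CK := (CK ord mu).
Local Notation right_char := (@right_char R E d ord H mu Hmu).
Local Notation check := (@check R E d ord H mu Hmu).

(** The character of limits from the left at [t]. *)
Definition left_char (t : E) : K := check (right_char (- t)).

Lemma cut_left t s : cut_of (left_char t) s <-> s <o t.
Proof.
rewrite /left_char; split.
  by move=> /cut_check; rewrite cut_right /= ole_opp => /negP; rewrite -ltNge.
by move=> st; apply/cut_check; rewrite cut_right /= ole_opp; apply/negP; rewrite -ltNge.
Qed.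

Lemma rayF_left t s : rayF t (left_char s) = (t <o s)%:R.
Proof.
rewrite rayFE; congr (_ %:R); congr nat_of_bool.
by apply/idP/idP => [/set_mem/cut_left|/cut_left/mem_set].
Qed.

(** At a right character, continuity of [g] on the double arrow space is
    continuity from the right. *)
Lemma right_limit (g : CK) (m : E) (e : C) : 0 < e ->
  exists2 s, m <o s & `|g (right_char m) - g (right_char s)| < e.
Proof.
move=> e0.
pose G : set_system K := [set V | exists2 u, m <o u &
  forall s, oitv m u s -> V (right_char s)].
have FG : Filter G.
  split.
  - by have [u m_u] := exists_gt m; exists u.
  - move=> V W [u m_u uV] [u' mu' uW]; exists (Order.min (u : with_order ord) u').
      by rewrite lt_min m_u.
    by move=> s [ms]; rewrite lt_min => /andP[su su']; split; [exact: uV|exact: uW].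
  - by move=> V W VW [u m_u uV]; exists u => // s sI; apply/VW/uV.
have Gm : G --> right_char m.
  apply: cvg_character_space => t; have [tm|mt] := leP (t : with_order ord) m.
    have [u m_u] := exists_gt m; exists u => // s [ms _]; rewrite !cut_right /=.
    by split=> // _; apply: le_trans tm _; exact: ltW.
  exists t => // s [_ st]; rewrite !cut_right /=.
  by split => h; [move: h; rewrite leNgt st|move: h; rewrite leNgt mt].
have gG : (g : K -> C) @ G --> g (right_char m).
  by move=> W /(@cts_fun _ _ g (right_char m)); exact: Gm.
have [u m_u uV] := (cvgC_distP _ _ FG).1 gG e e0.
have [s sI] := odense m_u.
by exists s; [exact: sI.1|exact: uV].
Qed.

Lemma left_limit (g : CK) (m a : E) (e : C) : a <o m -> 0 < e ->
  exists2 s, oitv a m s & `|g (left_char m) - g (right_char s)| < e.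
Proof.
move=> am e0.
pose G : set_system K := [set V | exists2 u, u <o m &
  forall s, oitv u m s -> V (right_char s)].
have FG : Filter G.
  split.
  - by exists a.
  - move=> V W [u m_u uV] [u' mu' uW]; exists (Order.max (u : with_order ord) u').
      by rewrite gt_max m_u.
    by move=> s []; rewrite gt_max => /andP[su su'] sm; split; [exact: uV|exact: uW].
  - by move=> V W VW [u m_u uV]; exists u => // s sI; apply/VW/uV.
have Gm : G --> left_char m.
  apply: cvg_character_space => t; have [mt|tm] := leP (m : with_order ord) t.
    exists a => // s [_ sm]; rewrite cut_right /=; split.
      by move=> ts; have := lt_le_trans sm (le_trans mt ts); rewrite ltxx.
    by move=> /cut_left => tm; have := lt_le_trans tm mt; rewrite ltxx.
  exists t => // s [ts sm]; rewrite cut_right /=.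
  by split => _; [exact/cut_left|exact: ltW].
have gG : (g : K -> C) @ G --> g (left_char m).
  by move=> W /(@cts_fun _ _ g (left_char m)); exact: Gm.
have [u um uV] := (cvgC_distP _ _ FG).1 gG e e0.
have aum : Order.max (a : with_order ord) u <o m by rewrite gt_max am um.
have [s [+ sm]] := odense aum; rewrite gt_max => /andP[as_ us].
by exists s; [split|apply: uV].
Qed.

(** The function [1 + F_t - F_(-t)] equals [0] on [{|x| < t}] and [1] outside
    when [t] is positive. *)
Definition step (t : E) : CK := 1 + rayF t - rayF (- t).

Lemma stepE t theta : step t theta = 1 + rayF t theta - rayF (- t) theta.
Proof. by rewrite !CK_addE CK_oppE. Qed.

Lemma step_even t : even_part (step t).
Proof. by move=> theta; rewrite !stepE !rayF_check opprK; ring. Qed.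

Lemma step_right t s : 0 <o t -> 0 <=o s -> step t (right_char s) = (t <=o s)%:R.
Proof.
move=> t0 s0; rewrite stepE !rayF_right.
have -> : (- t <=o s) = true.
  by apply: (le_trans _ s0); rewrite -[X in _ <=o X]oppr0 ole_opp ltW.
by rewrite addrAC subrr add0r.
Qed.

Lemma step_left t s : 0 <o t -> 0 <=o s -> step t (left_char s) = (t <o s)%:R.
Proof.
move=> t0 s0; rewrite stepE !rayF_left.
have -> : (- t <o s) = true.
  by apply: (lt_le_trans _ s0); rewrite -[X in _ <o X]oppr0 olt_opp.
by rewrite addrAC subrr add0r.
Qed.

(** A pointwise limit [g] of steps takes the values [0] and [1] on the right
    characters of positive points and increases there, so it jumps at a cut.
    That cut is of the form [{s < m}], because continuity of [g] from the right
    excludes [{s <= m}]. Steps which approximate [g] on both sides of [m] have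
    breakpoint [m]. *)
Lemma step_limit (c : E) (g : CK) : 0 <o c ->
  closure ([set step t | t in oitv 0 c] : set (with_topology (tau_p K C))) g ->
  exists2 t, oitv 0 c t & g = step t.
Proof.
move=> c0 clg.
have q0 : 0 < 4^-1 :> C by rewrite invr_gt0.
have approx2 theta1 theta2 : exists2 t, oitv 0 c t &
    `|g theta1 - step t theta1| < 4^-1 /\ `|g theta2 - step t theta2| < 4^-1.
  have [_ [[t tI <-] h]] := clg _ (filterI (near_tau_p theta1 g q0) (near_tau_p theta2 g q0)).
  by exists t.
pose near1 s := `|g (right_char s) - true%:R| < 4^-1.
(* The complement of [S] is the cut at which [g] jumps from [0] to [1]. *)
pose S : set E := [set s | 0 <o s /\ near1 s].
have Sc : S c.
  split => //; have [t [t0 tc] [+ _]] := approx2 (right_char c) (right_char c).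
  by rewrite step_right ?(ltW c0) // (ltW tc).
have Sup s s' : S s -> s <=o s' -> S s'.
  move=> [s0 ns] ss'; have s'0 := lt_le_trans s0 ss'.
  split => //; have [t [t0 tc] []] := approx2 (right_char s) (right_char s').
  rewrite !step_right ?(ltW s0) ?(ltW s'0) // => h h'.
  have ts := bool_close1 h ns.
  by move: h'; rewrite (le_trans ts ss').
have nS s : 0 <=o s -> ~ S s -> `|g (right_char s) - false%:R| < 4^-1.
  move=> s0 ns; have [t [t0 tc] [h _]] := approx2 (right_char s) (right_char s).
  rewrite step_right // in h; case: leP h => // ts h.
  by exfalso; apply: ns; split => //; exact: lt_le_trans ts.
have dS : down_set ord (~` S) by move=> s s' ss' ns' Ss; apply: ns'; exact: Sup ss'.
have nS0 : (~` S) 0 by move=> [h _]; rewrite ltxx in h.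
have [] := cut_max_or_min dS.
- by exists 0.
- by apply/eqP => /seteqP[_ /(_ c I)]; apply.
- move=> [m Sm].
  have m0 : 0 <=o m by move: nS0; rewrite Sm.
  have nSm : ~ S m by have : (~` S) m by rewrite Sm /= lexx.
  have [s ms gs] := right_limit g m q0.
  have Ss : S s by apply: contrapT => nSs; have : (~` S) s by []; rewrite Sm /= leNgt ms.
  by have := bool_close (nS m m0 nSm) Ss.2 gs.
move=> [m Sm].
have m0 : 0 <o m by move: nS0; rewrite Sm.
have Smm : S m by apply: contrapT => nSm; have : (~` S) m by []; rewrite Sm /= ltxx.
have gl t : 0 <o t -> `|g (left_char m) - step t (left_char m)| < 4^-1 -> m <=o t.
  move=> t0; rewrite step_left // ?(ltW m0) // => h.
  have [s [s0 sm] gs] := left_limit g m0 q0.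
  have nSs : ~ S s by have : (~` S) s by rewrite Sm.
  have := bool_close h (nS s (ltW s0) nSs) gs.
  by case: ltP.
have gr t : 0 <o t -> `|g (right_char m) - step t (right_char m)| < 4^-1 -> t <=o m.
  move=> t0; rewrite step_right // ?(ltW m0) // => h.
  exact: bool_close1 h Smm.2.
have [t [t0 tc] [h1 h2]] := approx2 (right_char m) (left_char m).
have tm : t = m by apply: (@le_anti _ (with_order ord)); rewrite gl // gr.
exists m; first by rewrite -tm.
apply: CK_ext => theta; apply: le_all_eps => e e0.
have [_ [[t' [t'0 _] <-] [[h1' h2'] h3]]] := clg _ (filterI
  (filterI (near_tau_p (right_char m) g q0) (near_tau_p (left_char m) g q0))
  (near_tau_p theta g e0)).
have t'm : t' = m by apply: (@le_anti _ (with_order ord)); rewrite gl // gr.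
have {}h3 : `|g theta - step t' theta| < e := h3.
rewrite -t'm; apply: (le_trans (ltW h3)).
by rewrite lerDl ltW.
Qed.

End even_steps.

Section discrete_steps.
Context {R : realType} {E : topologicalZmodType} {d : Order.disp_t}
  {ord : Order.Total d E} {H : separable_ordered_group ord}.
Context {mu : {measure set (borel_type E) -> \bar R}} {Hmu : haar_measure mu}.
Local Notation "x <o y" := ((x : with_order ord) < (y : with_order ord))%O
  (at level 70, y at next level).
Local Notation oitv := (open_interval ord).
Local Notation C := (Cplx R).
Local Notation K := (character_space ord mu).
Local Notation CK := (CK ord mu).
Local Notation right_char := (@right_char R E d ord H mu Hmu).
Local Notation left_char := (@left_char R E d ord H mu Hmu).
Local Notation even_part := (@even_part R E d ord H mu Hmu).
Local Notation step := (@step R E d ord mu).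
Local Notation A := (ray_algebra ord mu).
Local Notation ray := (ray_indicator R ord).

Definition step_fun (t x : E) : C := 1 + ray t x - ray (- t) x.

Lemma A_add a b : A a -> A b -> A (fun x => a x + b x).
Proof.
by move=> Aa Ab; have := A_ZD 1 Aa Ab; under eq_fun do rewrite mul1r.
Qed.

Lemma A_step_fun t : A (step_fun t).
Proof.
have h : A (fun x => 1 + ray t x) by apply: A_add; [exact: A_1|exact: A_ray].
have := A_ZD (-1) (A_ray (- t)) h; congr A; apply/funext => x.
by rewrite /step_fun mulN1r addrC.
Qed.

Lemma ev_step_fun t theta : ev theta (step_fun t) = step t theta.
Proof.
have h : A (fun x => 1 + ray t x) by apply: A_add; [exact: A_1|exact: A_ray].
have -> : step_fun t = (fun x => (-1) * ray (- t) x + (1 * (fun=> 1) x + ray t x)).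
  by apply/funext => x; rewrite /step_fun mulN1r mul1r addrC.
rewrite (evZD theta (-1) (A_ray (- t))); last exact: (A_ZD 1 A_1 (A_ray t)).
by rewrite (evZD theta 1 A_1 (A_ray t)) ev1 mul1r mulN1r addrC stepE.
Qed.

(** Reflection preserves the step function off its two breakpoints. *)
Lemma step_fun_check t : {ae mu, forall x, step_fun t (- x) = step_fun t x}.
Proof.
apply: (@negligibleS _ (borel_type E) R mu [set t; - t]); last first.
  by apply: countable_negligible; exact: finite_set_countable.
move=> x /= nx; apply: contrapT => /not_orP[/eqP xt /eqP xt']; apply: nx.
rewrite /step_fun /ray_indicator olt_opp.
have -> : (t <o - x) = ~~ (- t <o x).
  rewrite -[t in LHS]opprK olt_opp -leNgt le_eqVlt.
  have -> : ((x : with_order ord) == - t) = false.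
    by apply/negbTE/eqP => e; move: xt'; rewrite e eqxx.
  by [].
have -> : (x <o t) = ~~ (t <o x).
  rewrite -leNgt le_eqVlt.
  have -> : ((x : with_order ord) == t) = false.
    by apply/negbTE/eqP => e; move: xt; rewrite e eqxx.
  by [].
by case: (t <o x); case: (- t <o x) => /=; ring.
Qed.

Lemma step_even012 t : even_functions012 (step t).
Proof.
have As : A (step_fun t) := A_step_fun t.
have bs : borel_fun (fun x => step_fun t (- x)).
  have [b _] := A_Linfty As.
  apply: (@borel_fun_comp E E C (fun x => - x) (step_fun t)) => //.
  by apply: continuous_borel_fun; exact: opp_continuous.
have Ac : A (fun x => step_fun t (- x)) by exact: (A_ae bs (step_fun_check t) As).
split.
  exists (SigSub (mem_set As)), (SigSub (mem_set Ac)); split.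
  - by move=> theta; rewrite -gelE -/(ev _ _) ev_step_fun.
  - move=> theta; rewrite -gelE; rewrite (gel_eq_ae (character_val theta) Ac As) //.
      by rewrite -/(ev _ _) ev_step_fun.
    exact: step_fun_check.
  - exact: aeW.
move=> theta; rewrite stepE !rayFE.
case: (t \in _); case: (- t \in _) => /=.
- by constructor 2; rewrite addrK.
- by constructor 3; rewrite subr0.
- by constructor 1; rewrite addr0 subrr.
- by constructor 2; rewrite addr0 subr0.
Qed.

(** The breakpoint of a step can be read off at the two characters of [t],
    which gives a neighbourhood isolating each step. *)
Lemma step_eq t t' : 0 <o t -> 0 <o t' ->
  `|step t (right_char t) - step t' (right_char t)| < 4^-1 ->
  `|step t (left_char t) - step t' (left_char t)| < 4^-1 -> t' = t.
Proof.
move=> t0 t'0; rewrite !step_right ?step_left ?(ltW t0) // => h1 h2.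
have z (b : bool) : `|b%:R - b%:R : C| < 4^-1 by rewrite subrr normr0 invr_gt0.
have e1 := bool_close (z _) (z _) h1; have e2 := bool_close (z _) (z _) h2.
move: e1 e2; rewrite lexx ltxx => e1 /esym/negbT; rewrite -leNgt => e2.
by apply: (@le_anti _ (with_order ord)); rewrite -e1 e2.
Qed.

(** The even steps with breakpoints in [oitv 0 c]. They are uncountable because
    the Vitali set is not Borel, hence not contained in a countable set. *)
Lemma even_discrete_set :
  exists D : set (@subspace_type (with_topology (tau_p K C)) even_part),
    [/\ closed D, isolated D = D, ~ countable D &
        forall y, D y -> even_functions012 (val y)].
Proof.
have [c [V [c0 Vc nV]]] := non_borel_set (ord := ord) (mu := mu).
pose T := with_topology (tau_p K C).
have q0 : 0 < 4^-1 :> C by rewrite invr_gt0.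
pose D := [set y : @subspace_type T even_part | exists2 t, oitv 0 c t & val y = step t].
have vc : continuous (val : @subspace_type T even_part -> T) by exact: initial_continuous.
exists D; split.
- move=> y cly; apply: step_limit => // N /(vc y) Ny.
  by have [z [[t tI zt] Nz]] := cly _ Ny; exists (step t); split; [exists t|rewrite -zt].
- apply/seteqP; split => [y /isolatedS//|y Dy]; split; first exact: mem_set.
  have [t [t0 tc] yt] := Dy.
  pose W : set CK := [set h : CK | `|step t (right_char t) - h (right_char t)| < 4^-1]
    `&` [set h : CK | `|step t (left_char t) - h (left_char t)| < 4^-1].
  have NW : nbhs (val y : T) W.
    rewrite yt; apply: (@filterI _ _ (nbhs_filter (step t : T))); exact: near_tau_p.
  exists (val @^-1` W); first exact: (vc y _ NW).
  apply/seteqP; split => [z [[h1 h2] [t' [t'0 _] zt']]|z ->]; last first.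
    by split => //; exact: nbhs_singleton NW.
  by apply: val_inj; rewrite zt' yt; congr step; apply: step_eq => //; rewrite -zt'.
- move=> /countable_injP[f finj]; apply: nV.
  suff cI : countable (oitv 0 c).
    by apply: countable_borel; exact: sub_countable (subset_card_le Vc) cI.
  pose s (t : E) : @subspace_type T even_part := SigSub (mem_set (step_even t)).
  apply/countable_injP; exists (f \o s) => t t' /set_mem tI /set_mem t'I /= ff.
  have /(congr1 val) /= st : s t = s t'.
    by apply: finj ff; apply/mem_set; [exists t|exists t'].
  by apply/esym/step_eq; [exact: tI.1|exact: t'I.1| |]; rewrite st subrr normr0.
- by move=> y [t _ ->]; exact: step_even012.
Qed.

End discrete_steps.

(** * The compactification of a completely regular space *)

Section stone_cech_existence.
Context {R : realType} (X : topologicalType) (x0 : X).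
Hypothesis X_hausdorff : hausdorff_space X.
Hypothesis X_regular : @completely_regular_space X.

Definition bounded_continuous : set (X -> R) :=
  [set f | continuous f /\ exists M, forall x, `|f x| <= M].

Local Notation P := {ptws bounded_continuous -> R}.

Definition evaluations (x : X) : P := fun f => val f x.

Definition compactification := @subspace_type P (closure (range evaluations)).

Definition embedding (x : X) : compactification :=
  SigSub (mem_set (subset_closure (imageT evaluations x))).

Definition pointed_compactification : ptopologicalType :=
  HB.pack_for ptopologicalType compactification
    (isPointed.Build compactification (embedding x0)).

Lemma coordinate_continuous f : continuous (fun b : compactification => val b f).
Proof.
move=> b; apply: (@continuous_comp _ _ _ (val : compactification -> P) (fun g : P => g f)).
  exact: initial_continuous.
exact: (@proj_continuous bounded_continuous (fun _ => R)).
Qed.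

Lemma cvg_compactification (T : Type) (F : set_system T) (h : T -> compactification)
    (b : compactification) :
  Filter F -> (forall f, val (h t) f @[t --> F] --> val b f) -> h @ F --> b.
Proof.
by move=> FF hF; apply: cvg_initial; apply: cvg_ptws => f; exact: hF.
Qed.

Lemma embedding_continuous : continuous embedding.
Proof.
move=> x; apply: cvg_compactification => f.
by have [cf _] := set_valP f; exact: cf.
Qed.

Lemma P_hausdorff : hausdorff_space P.
Proof. by apply: hausdorff_product => _; exact: Rhausdorff. Qed.

Lemma compactification_hausdorff : hausdorff_space compactification.
Proof.
move=> p q pq; apply: val_inj; apply/funext => f.
apply: Rhausdorff => A B nA nB.
have [b [? ?]] := pq _ _ (@coordinate_continuous f p _ nA) (@coordinate_continuous f q _ nB).
by exists (val b f).
Qed.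

Lemma compactification_compact : compact [set: compactification].
Proof.
pose M (f : bounded_continuous) := sval (cid (set_valP f).2).
have MP f x : `|val f x| <= M f by rewrite /M; case: cid.
pose box : set P := [set g | forall f, `[- M f, M f]%classic (g f)].
have cbox : compact box.
  by apply: (@tychonoff bounded_continuous (fun _ => R)
    (fun f => `[- M f, M f]%classic)) => f; exact: segment_compact.
have sub : closure (range evaluations) `<=` box.
  have -> : box = closure box by apply/closure_id; exact: (compact_closed P_hausdorff cbox).
  apply: closureS => _ [x _ <-] f /=; rewrite in_itv /= -ler_norml; exact: MP.
have ccl : compact (closure (range evaluations)).
  exact: (subclosed_compact (@closed_closure _ _) cbox sub).
rewrite compact_ultra in ccl; rewrite compact_ultra => F FU _.
have [] := ccl ((val : compactification -> P) @ F) (fmap_ultra _ FU).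
  suff : F [set b : compactification | closure (range evaluations) (val b)] by [].
  by apply: filterE => b; exact: (set_valP b).
move=> p [pc Fp]; exists (SigSub (mem_set pc)); split => //.
exact: cvg_initial.
Qed.

(** Complete regularity: a function separating [x] from the complement of [U]
    is one of the coordinates. *)
Lemma embedding_nbhs x U : nbhs x U ->
  exists2 V : set compactification, nbhs (embedding x) V & embedding @^-1` V `<=` U.
Proof.
rewrite nbhsE => -[W [oW Wx] WU].
have /(@uniform_separatorP X R)[f [cf f01 fx fO]] := X_regular (open_closedC oW) (fun nW => nW Wx).
have bf : bounded_continuous f.
  split => //; exists 1 => y; have /f01 : range f (f y) by exists y.
  by rewrite /= in_itv /= => /andP[f0 f1]; rewrite ger0_norm.
pose bfI : bounded_continuous := SigSub (mem_set bf).
exists [set b : compactification | val b bfI < 1].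
  have fx0 : f x = 0 by apply: fx; exists x.
  apply: (@coordinate_continuous bfI (embedding x) [set r | r < 1]).
  have -> : val (embedding x) bfI = 0 by rewrite -fx0.
  exact: (@lt_nbhsl _ _ (1 : R)).
move=> y /= fy; apply: WU; apply: contrapT => nWy.
have fy1 : f y = 1 by apply: fO; exists y.
have : f y < 1 := fy.
by rewrite fy1 ltxx.
Qed.

Lemma embedding_inj : injective embedding.
Proof.
move=> x y xy; apply: X_hausdorff => A B.
move=> /embedding_nbhs[V nV VA] nB; exists y; split; last exact: nbhs_singleton.
by apply: VA; rewrite /= -xy; exact: nbhs_singleton.
Qed.

Lemma stone_cech_exists : @stone_cech R X pointed_compactification embedding.
Proof.
split.
- exact: compactification_compact.
- exact: compactification_hausdorff.
- split.
    by move=> x; apply: cvg_initial; exact: embedding_continuous.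
  pose k (y : @subspace_type compactification (range embedding)) : X :=
    sval (cid2 (set_valP y)).
  have kP y : embedding (k y) = val y by rewrite /k; case: cid2.
  exists k; split.
  + move=> y U; rewrite /= => /embedding_nbhs[V]; rewrite kP => nV VU.
    have : nbhs y (val @^-1` V) by exact: initial_continuous.
    apply: filterS => z Vz; apply: VU; rewrite /= kP; exact: Vz.
  + by move=> x; apply: embedding_inj; rewrite kP.
  + by move=> y; apply: val_inj; exact: kP.
- move=> W [b Wb] [W' oW' WW'].
  have cb : closure (range evaluations) (val b) := set_valP b.
  have [_ [[x _ <-] W'x]] : (range evaluations `&` W') !=set0.
    apply: cb; apply: open_nbhs_nbhs; split => //.
    by rewrite -WW' in Wb.
  exists (embedding x); split; last by exists x.
  by rewrite -WW'.
- move=> f cf bf; pose bfI : bounded_continuous := SigSub (mem_set (conj cf bf)).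
  by exists (fun b => val b bfI); [exact: coordinate_continuous|].
Qed.

End stone_cech_existence.

(** * Radon measures on compact spaces *)

Section radon.
Local Open Scope ereal_scope.
Context {R : realType} (B : ptopologicalType).
Hypothesis B_compact : compact [set: B].
Hypothesis B_hausdorff : hausdorff_space B.
Variable lam : {finite_measure set (g_sigma_algebraType (@open B)) -> \bar R}.
Hypothesis open_inner : forall (U : set B) (e : R), open U -> (0 < e)%R ->
  exists F : set B, [/\ closed F, F `<=` U & lam (U `\` F) < e%:E].
Local Notation M := (g_sigma_algebraType (@open B)).

Let open_meas (U : set B) : open U -> measurable (U : set M).
Proof. exact: sub_gen_smallest. Qed.

Let closed_meas (U : set B) : closed U -> measurable (U : set M).
Proof.
by move=> cU; rewrite -[U]setCK; apply: measurableC; apply: open_meas; rewrite openC.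
Qed.

(** Approximation from inside by closed sets and from outside by open sets. The
    two-sided form is what makes the class stable under complements. *)
Definition regular_set (A : set B) := forall e : R, (0 < e)%R ->
  exists F W : set B, [/\ closed F, open W, F `<=` A, A `<=` W & lam (W `\` F) < e%:E].

(** The open sets are joined with errors [e / 2 ^ n.+2], and a finite union of
    the closed sets suffices by continuity from above of the finite measure. *)
Lemma regular_bigcup (A : nat -> set B) : (forall n, regular_set (A n)) ->
  regular_set (\bigcup_n A n).
Proof.
move=> rA e e0.
have e2 : (0 < e / 2)%R by rewrite divr_gt0.
have en n : (0 < e / 2 / (2 ^ n.+1)%:R)%R by rewrite divr_gt0 // ltr0n expn_gt0.
have /choice[FO FOP] : forall n, exists p : set B * set B,
    [/\ closed p.1, open p.2, p.1 `<=` A n, A n `<=` p.2 &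
        lam (p.2 `\` p.1) < (e / 2 / (2 ^ n.+1)%:R)%:E].
  by move=> n; have [F [W h]] := rA n _ (en n); exists (F, W).
pose F n := (FO n).1; pose W n := (FO n).2.
have cF n : closed (F n) by have [] := FOP n.
have oW n : open (W n) by have [] := FOP n.
have mF n : measurable (F n : set M) by exact: closed_meas.
have mW n : measurable (W n : set M) by exact: open_meas.
have mUF : measurable (\bigcup_n F n : set M) by exact: bigcupT_measurable.
have mUO : measurable (\bigcup_n W n : set M) by exact: bigcupT_measurable.
pose G N : set B := \big[setU/set0]_(n < N) F n.
have mG N : measurable (G N : set M) by apply: bigsetU_measurable.
have GF N : G N `<=` \bigcup_n F n.
  by rewrite /G -bigcup_mkord => x [n _ Fx]; exists n.
have big : lam (\bigcup_n W n `\` \bigcup_n F n) <= (e / 2)%:E.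
  apply: (@le_trans _ _ (\sum_(n <oo) lam (W n `\` F n))).
    apply: measure_sigma_subadditive.
    - by move=> n; exact: measurableD.
    - exact: measurableD.
    - by move=> x [[n _ Ox] nF]; exists n => //; split => // Fx; apply: nF; exists n.
  apply: le_trans (_ : \sum_(n <oo) (e / 2 / (2 ^ n.+1)%:R)%:E <= _).
    by apply: lee_nneseries => // n _; apply: ltW; have [] := FOP n.
  exact: epsilon_trick0 (ltW e2).
have [N GN] : exists N, lam (\bigcup_n F n `\` G N) < (e / 2)%:E.
  have cv : lam (\bigcup_n F n `\` G n) @[n --> \oo] --> lam (\bigcap_n (\bigcup_n F n `\` G n)).
    apply: (@nonincreasing_cvg_mu _ M R lam (fun n => \bigcup_n F n `\` G n)).
    - by rewrite -ge0_fin_numE // fin_num_measure //; exact: measurableD.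
    - by move=> i; exact: measurableD.
    - by apply: bigcapT_measurable => n; exact: measurableD.
    - move=> m n mn; apply/subsetPset => x [Fx nG]; split => // Gm; apply: nG.
      by move: Gm; rewrite /G -!bigcup_mkord => -[k /= km Fk]; exists k => //=; exact: leq_trans mn.
  have z : \bigcap_n (\bigcup_n F n `\` G n) = set0.
    apply/seteqP; split => // x xn; have [[n _ Fx] _] := xn 0%N I.
    have [_ nG] := xn n.+1 I; apply: nG.
    by rewrite /G -bigcup_mkord; exists n => //=.
  rewrite z measure0 in cv.
  have [|N _ hN] := cv [set x | x < (e / 2)%:E].
    by apply: open_ereal_lt'; rewrite lte_fin.
  by exists N; apply: (hN N) => /=.
exists (G N), (\bigcup_n W n); split.
- by rewrite /G; apply: big_ind => //; [exact: closed0|exact: closedU].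
- exact: bigcup_open.
- by move=> x /GF[n _ Fx]; exists n => //; have [_ _ h _ _] := FOP n; exact: h.
- by move=> x [n _ Ax]; exists n => //; have [_ _ _ h _] := FOP n; exact: h.
- apply: (@le_lt_trans _ _ (lam (\bigcup_n W n `\` \bigcup_n F n) + lam (\bigcup_n F n `\` G N))).
    apply: le_trans (measureU2 _ _ _).
    + apply: le_measure; rewrite ?inE; [exact: measurableD| |].
        by apply: measurableU; exact: measurableD.
      move=> x [Ox nG]; have [Fx|nF] := pselect ((\bigcup_n F n) x); first by right.
      by left.
    + exact: measurableD.
    + exact: measurableD.
  by rewrite [e]splitr EFinD lee_ltD // fin_num_measure //; exact: measurableD.
Qed.

Lemma borel_regular (A : set B) : borel_sets A -> regular_set A.
Proof.
suff : @borel_sets B `<=` regular_set by apply.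
apply: smallest_sub.
  split.
  - move=> e e0; exists set0, set0; split => //; [exact: closed0|exact: open0|].
    have -> : set0 `\` set0 = set0 :> set B by rewrite setD0.
    by rewrite measure0 lte_fin.
  - move=> A' rA e e0; have [F [W [cF oW FA AW FW]]] := rA e e0.
    exists (~` W), (~` F); split; rewrite ?setTD.
    + by rewrite closedC.
    + by rewrite openC.
    + exact: subsetC.
    + exact: subsetC.
    + by rewrite setDE setCK setIC -setDE.
  - exact: regular_bigcup.
move=> U oU e e0; have [F [cF FU UF]] := open_inner oU e0.
by exists F, U; split => //; exact: subset_refl.
Qed.

(** On a compact space, inner approximation by closed sets needs to be checked
    on open sets only. *)
Lemma finite_radon_open_inner : finite_radon lam.
Proof.
move=> A bA; apply/eqP; rewrite eq_le; apply/andP; split; last first.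
  apply: ge_ereal_sup => _ [F [cF FA] <-].
  apply: le_measure; rewrite ?inE //.
  exact: (closed_meas (compact_closed B_hausdorff cF)).
apply/lee_addgt0Pr => e e0; have [F [W [cF oW FA AW FW]]] := borel_regular bA e0.
apply: (@le_trans _ _ (lam F + lam (W `\` F))).
  apply: le_trans (measureU2 _ _ _).
  - apply: le_measure; rewrite ?inE //.
      apply: measurableU; first exact: closed_meas.
      by apply: measurableD; [exact: open_meas|exact: closed_meas].
    move=> x Ax; have [|nF] := pselect (F x); first by left.
    by right; split => //; exact: AW.
  - exact: closed_meas.
  - by apply: measurableD; [exact: open_meas|exact: closed_meas].
apply: leeD; last exact: ltW.
apply: ereal_sup_ubound; exists F => //; split => //.
exact: (subclosed_compact cF B_compact).
Qed.

End radon.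

(** * Pushing Haar measure forward along a left-continuous curve *)

Section pushed.
Context {R : realType} {E : topologicalZmodType} {d : Order.disp_t}
  {ord : Order.Total d E} {H : separable_ordered_group ord}.
Context {mu : {measure set (borel_type E) -> \bar R}} {Hmu : haar_measure mu}.
Local Notation "x <o y" := ((x : with_order ord) < (y : with_order ord))%O
  (at level 70, y at next level).
Local Notation "x <=o y" := ((x : with_order ord) <= (y : with_order ord))%O
  (at level 70, y at next level).
Local Notation oitv := (open_interval ord).
Context (B : ptopologicalType) (phi : E -> B) (c : E).
Hypothesis B_compact : compact [set: B].
Hypothesis B_hausdorff : hausdorff_space B.
Hypothesis phi_left : forall t U, nbhs (phi t) U ->
  exists2 s, s <o t & forall u, s <o u -> u <=o t -> U (phi u).
Hypothesis c_fin : (mu (oitv (- c)%R c) < +oo)%E.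
Local Notation J := (oitv (- c) c).
Local Notation M := (g_sigma_algebraType (@open B)).

Let phi_borel : borel_fun phi.
Proof.
apply: borel_fun_open => U oU; apply: left_open_borel => t Ut.
by apply: phi_left; exact: (open_nbhs_nbhs (conj oU Ut)).
Qed.

Let mJ : measurable (J : set (borel_type E)).
Proof. by apply: open_borel; exact: open_oitv. Qed.

Definition pushed (A : set M) : \bar R := mu (phi @^-1` A `&` J).

Let mpre (A : set B) : measurable (A : set M) ->
  measurable (phi @^-1` A `&` J : set (borel_type E)).
Proof. by move=> mA; apply: measurableI => //; exact: phi_borel. Qed.

Let pushed0 : pushed set0 = 0%E.
Proof. by rewrite /pushed preimage_set0 set0I measure0. Qed.

Let pushed_ge0 A : (0 <= pushed A)%E.
Proof. exact: measure_ge0. Qed.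

Let pushed_additive : semi_sigma_additive pushed.
Proof.
move=> F mF tF mUF; rewrite /pushed preimage_bigcup setI_bigcupl.
apply: measure_semi_sigma_additive.
- by move=> n; exact: mpre.
- apply/trivIsetP => /= i j _ _ ij; rewrite setIACA -preimage_setI.
  by move/trivIsetP : tF => /(_ _ _ _ _ ij) ->//; rewrite preimage_set0 set0I.
- by rewrite -setI_bigcupl -preimage_bigcup; exact: mpre.
Qed.

HB.instance Definition _ := isMeasure.Build _ _ _ pushed
  pushed0 pushed_ge0 pushed_additive.

Let pushed_finite : fin_num_fun pushed.
Proof.
move=> A mA; rewrite ge0_fin_numE // (le_lt_trans _ c_fin) //.
by apply: le_measure; rewrite ?inE //; exact: mpre.
Qed.

HB.instance Definition _ := Measure_isFinite.Build _ _ _ pushed pushed_finite.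

Let regular (U : set B) (b : B) : open U -> U b ->
  exists V : set B, [/\ open V, V b & closure V `<=` U].
Proof.
move=> oU Ub.
have [V nV VU] := @compact_regular B b [set: B] B_hausdorff B_compact
  (@filterT _ _ (nbhs_filter b)) U (open_nbhs_nbhs (conj oU Ub)).
exists V°; split; [exact: open_interior|exact: nV|].
by apply: subset_trans VU; apply: closureS; exact: interior_subset.
Qed.

(** The preimage of [U] under a left-continuous curve is open up to countably
    many points. By regularity of the compact space, its open part is covered
    by the interiors of the preimages of open sets whose closures lie in [U];
    inner regularity of Haar measure leaves finitely many of these closures. *)
Let open_inner (U : set B) (e : R) : open U -> 0 < e ->
  exists F : set B, [/\ closed F, F `<=` U & (pushed (U `\` F) < e%:E)%E].
Proof.
move=> oU e0.
pose D : set (set B) := [set V | open V /\ closure V `<=` U].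
pose W := \bigcup_(V in D) (phi @^-1` V)°.
have oW : open W by apply: bigcup_open => V _; exact: open_interior.
have cZ : countable (phi @^-1` U `\` W).
  apply: (left_isolated_countable (ord := ord)) => t [Ut _].
  have [V [oV Vt VU]] := regular oU Ut.
  have [s st sV] := phi_left (open_nbhs_nbhs (conj oV Vt)).
  exists s => //; apply/seteqP; split => // u [[su ut] [_]].
  apply; exists V => //.
  apply: filterS (open_nbhs_nbhs (conj (open_oitv s t) (conj su ut))) => v [sv vt].
  by apply: sV => //; exact: ltW.
have oJW : open (J `&` W) by apply: openI => //; exact: open_oitv.
have JWfin : mu (J `&` W) \is a fin_num.
  rewrite ge0_fin_numE // (le_lt_trans _ c_fin) //.
  by apply: le_measure; rewrite ?inE //; exact: open_borel.
have inner : mu (J `&` W) =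
    ereal_sup [set mu A | A in [set A : set E | compact A /\ A `<=` J `&` W]].
  by case: Hmu => _ _ _ _; exact.
have := JWfin; rewrite {1}inner => supfin.
have [_ [A [cA AJW] <-] Ae] := ub_ereal_sup_adherent e0 supfin.
rewrite -inner in Ae.
have [V oV|x Ax|D' [fD' D'D AD']] := @finite_subcover E (0 : E) A (set B) D
    (fun V => (phi @^-1` V)°) cA.
- exact: open_interior.
- by have [_] := AJW x Ax.
pose F := \bigcup_(V in D') closure V.
have cF : closed F.
  by apply: closed_bigcup => // V _; exact: closed_closure.
exists F; split => //.
  by move=> b [V /D'D VD Vb]; have [_ VU] := VD; exact: VU.
have mA : measurable (A : set (borel_type E)).
  exact: (closed_borel (compact_closed (@ordered_group_hausdorff _ _ _ H) cA)).
have mZ : measurable (phi @^-1` U `\` W : set (borel_type E)) by exact: countable_borel.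
have mD : measurable ((J `&` W) `\` A : set (borel_type E)).
  by apply: measurableD => //; exact: open_borel.
apply: (@le_lt_trans _ _ (mu (phi @^-1` U `\` W) + mu ((J `&` W) `\` A)))%E.
  apply: le_trans (measureU2 _ mZ mD).
  apply: le_measure; rewrite ?inE.
  - apply: mpre; apply: measurableD; first exact: sub_gen_smallest.
    by rewrite -[F]setCK; apply: measurableC; apply: sub_gen_smallest; rewrite openC.
  - exact: measurableU.
  - move=> x [[Ux nFx] Jx]; have [Wx|] := pselect (W x); last by left.
    right; split => // Ax; have [V VD' Vx] := AD' x Ax; apply: nFx.
    by exists V => //; apply: subset_closure; exact: interior_subset Vx.
rewrite (measure_negligible mZ (countable_negligible cZ)) add0e.
rewrite measureD ?(setIidr AJW) //; [|exact: open_borel|by rewrite -ge0_fin_numE].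
have Afin : mu A \is a fin_num.
  rewrite ge0_fin_numE // (@le_lt_trans _ _ (mu (J `&` W))) -?ge0_fin_numE //.
  by apply: le_measure; rewrite ?inE //; exact: open_borel.
move: Ae; rewrite -(fineK JWfin) -(fineK Afin) -EFinB lte_fin => Ae.
suff : (mu (J `&` W) - mu A < e%:E)%E by [].
rewrite -(fineK JWfin) -(fineK Afin) -EFinB lte_fin; lra.
Qed.

(** The image measure is Radon although the curve need not be continuous. *)
Lemma pushed_radon :
  exists2 lam : {finite_measure set (g_sigma_algebraType (@open B)) -> \bar R},
  finite_radon lam & forall A, borel_sets A -> lam A = mu (phi @^-1` A `&` J).
Proof.
by exists pushed => //; apply: finite_radon_open_inner.
Qed.

End pushed.

(** * Failure of universal measurability *)

Section not_universally_measurable.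
Context {R : realType} {E : topologicalZmodType} {d : Order.disp_t}
  {ord : Order.Total d E} {H : separable_ordered_group ord}.
Context {mu : {measure set (borel_type E) -> \bar R}} {Hmu : haar_measure mu}.
Local Notation "x <o y" := ((x : with_order ord) < (y : with_order ord))%O
  (at level 70, y at next level).
Local Notation "x <=o y" := ((x : with_order ord) <= (y : with_order ord))%O
  (at level 70, y at next level).
Local Notation oitv := (open_interval ord).
Local Notation C := (Cplx R).
Local Notation CK := (CK ord mu).
Local Notation tau' := (@tau' R E d ord mu).
Local Notation right_char := (@right_char R E d ord H mu Hmu).
Local Notation rayF := (@rayF R E d ord mu).
Local Notation X := (with_topology tau').

(** The topology is initial for a map into a product of copies of the plane,
    hence uniformizable. *)
Lemma completely_regular_tau' : @completely_regular_space X.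
Proof.
exact: (@uniform_completely_regular R (initial_topology
  (fun g : CK => (fun s => g (val s)) :
     {ptws (@right_characters R E d ord mu) -> C}) : uniformType)).
Qed.

Local Notation B := (@pointed_compactification R X (0 : CK)).
Local Notation e := (@embedding R X).
Let phi (t : E) : B := e (rayF t).

(** Otherwise the rays of points of the preimage decreasing to [t] would have a
    cluster point [g] in the compact set, which comes from a continuous function
    on the character space: its value is [0] at the right of [t] but [1] at the
    right of every [s > t], against continuity from the right. *)
Lemma right_isolated (A : set B) (t : E) : compact A -> A `<=` range e ->
  exists2 s, t <o s & oitv t s `&` phi @^-1` A = set0.
Proof.
move=> cA Ae; apply: contrapT => noniso.
(* The filter of the points of the preimage of [A] which decrease to [t]. *)
pose G : set_system E := [set V | exists2 s, t <o s &
  forall u, oitv t s u -> A (phi u) -> V u].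
have FG : ProperFilter G.
  split.
    move=> [s ts s0]; apply: noniso; exists s => //.
    by apply/seteqP; split => // u [us Au]; exact: (s0 u us Au).
  split.
  - by have [s ts] := exists_gt t; exists s.
  - move=> V W [s st sV] [s' st' sW]; exists (Order.min (s : with_order ord) s').
      by rewrite lt_min st.
    move=> u [tu]; rewrite lt_min => /andP[us us'] Au.
    by split; [exact: sV|exact: sW].
  - by move=> V W VW [s st sV]; exists s => // u us Au; apply/VW/sV.
have GA : (phi @ G) A.
  by have [s ts] := exists_gt t; exists s.
have [b [Ab clb]] := cA (phi @ G) (fmap_proper_filter phi FG) GA.
have [g _ eg] := Ae b Ab.
have [s ts gts] := @right_limit R E d ord H mu Hmu g t 4^-1 ltac:(by rewrite invr_gt0).
pose close m : set X := [set h : CK | `|g (right_char m) - h (right_char m)| < 4^-1].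
have nclose m : nbhs (g : X) (close m).
  have := @eval_right R E d ord H mu Hmu m g.
  by move=> /cvgC_distP; apply; rewrite invr_gt0.
have [V nV VU] := embedding_nbhs (R := R) completely_regular_tau' (filterI (nclose t) (nclose s)).
have GI : (phi @ G) (phi @` (oitv t s)).
  by exists s => // u us _; exists u.
have nVb : nbhs b V by rewrite -eg.
have [_ [[u [tu us] <-] Vu]] := clb _ _ GI nVb.
have [] := VU (rayF u) Vu.
rewrite /close /= !rayF_right => ut' us'.
have ft : (u <=o t) = false by apply: lt_geF.
have fs : (u <=o s) = true by apply: ltW.
rewrite ft in ut'; rewrite fs in us'.
by have := bool_close ut' us' gts.
Qed.

(** Sets isolated from the right are countable by reflection. *)
Lemma countable_compact_rays (A : set B) : compact A -> A `<=` range e ->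
  countable (phi @^-1` A).
Proof.
move=> cA Ae.
have : countable [set - t | t in phi @^-1` A].
  apply: (left_isolated_countable (ord := ord)) => _ [t At <-].
  have [s ts sA] := right_isolated t cA Ae.
  exists (- s); first by rewrite olt_opp.
  apply/seteqP; split => // x [[sx xt] [u Au ux]].
  move: sx xt; rewrite -ux !olt_opp => us tu.
  by have : (oitv t s `&` phi @^-1` A) u by []; rewrite sA.
move=> cN; rewrite (_ : phi @^-1` A = [set - t | t in [set - t | t in phi @^-1` A]]); last first.
  apply/seteqP; split => [t At|_ [_ [t At <-] <-]]; last by rewrite opprK.
  by exists (- t); [exists t|rewrite opprK].
by apply: card_le_trans cN; exact: card_image_le.
Qed.

(** The image measure of an interval under the curve of rays is carried by the
    space, so every Borel superset has full measure; but a Borel subset is null,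
    as its compact subsets contain countably many rays only. *)
Lemma not_universally_measurable : ~ universally_measurable R X.
Proof.
move=> univ.
have sc := @stone_cech_exists R X (0 : CK) (@hausdorff_tau' R E d ord H mu Hmu)
  completely_regular_tau'.
have [c c0 cfin] := finite_interval (ord := ord) (mu := mu).
have phi_left t U : nbhs (phi t) U ->
    exists2 s, s <o t & forall u, s <o u -> u <=o t -> U (phi u).
  move=> nU; apply: (@rayF_left_continuous R E d ord H mu (e @^-1` U) t).
  exact: (@embedding_continuous R X (rayF t) U nU).
have [lam lamR lamE] := pushed_radon (B := B) (phi := phi) (@compactification_compact R X)
  (@compactification_hausdorff R X) phi_left cfin.
have [A1 [A2 [bA1 bA2 A1e eA2 A12]]] := univ _ _ sc lam lamR.
have A10 : lam A1 = 0%E.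
  rewrite lamR //; apply/eqP; rewrite eq_le; apply/andP; split; last first.
    apply: ereal_sup_ubound; exists set0; last by rewrite measure0.
    by split => //; exact: compact0.
  apply: ge_ereal_sup => _ [A [cA AA1] <-].
  have cc := countable_compact_rays cA (subset_trans AA1 A1e).
  have bA : borel_sets A.
    have cl : closed A := compact_closed (@compactification_hausdorff R X) cA.
    rewrite -[A]setCK -setTD; have [_ sD _] := smallest_sigma_algebra setT (@open B).
    by apply: sD; apply: sub_gen_smallest; rewrite openC.
  rewrite lamE //; apply: le_trans (_ : mu (phi @^-1` A) <= 0)%E.
    apply: le_measure; rewrite ?inE; [|exact: countable_borel|exact: subIsetl].
    apply: countable_borel; apply: sub_countable cc; apply: subset_card_le; exact: subIsetl.
  exact: (eq_ind_r (fun x => x <= 0)%E (lexx _)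
    (measure_negligible (countable_borel cc) (countable_negligible cc))).
have A20 : lam A2 = 0%E.
  rewrite -(setDUK (subset_trans A1e eA2)); apply/eqP; rewrite eq_le measure_ge0 andbT.
  have A0 : (lam A1 + lam (A2 `\` A1) = 0)%E by rewrite A10 A12 adde0.
  rewrite -[leRHS]A0; apply: measureU2; first exact: bA1.
  by apply: measurableD; [exact: bA2|exact: bA1].
have : mu (oitv (- c) c) != 0%E.
  apply: mu_open_pos; first exact: open_oitv.
  by exists 0; split => //; rewrite -[X in _ <o X]oppr0 olt_opp.
apply/negP/negPn/eqP; rewrite -A20 lamE // (_ : phi @^-1` A2 = setT) ?setTI //.
by apply/seteqP; split => // t _; apply: eA2; exists (rayF t).
Qed.

End not_universally_measurable.

(** * Properties of the coarser topology *)

Theorem theorem5 (R : realType) (E : topologicalZmodType)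
    (d : Order.disp_t) (ord : Order.Total d E)
    (mu : {measure set (borel_type E) -> \bar R})
    (E_uncountable : ~ countable [set: E])
    (ord_group : forall a b : E,
      ((a : with_order ord) <= b)%O = (((a - b : E) : with_order ord) <= (0 : E))%O)
    (ord_topology : @open E = @open (order_topology (with_order ord)))
    (E_locally_compact : locally_compact [set: E])
    (E_separable : separable E)
    (E_connected : connected [set: E])
    (mu_haar : haar_measure mu) :
  let X := CK ord mu in
  let taup : Topological X := tau_p _ _ in
  exists (tau' : Topological X) (Y1 Y2 : set X),
    hausdorff_space (with_topology tau') /\
    cstar_subalgebra Y1 /\
    banach_subspace Y2 /\
    finer taup tau' /\
    ~ universally_measurable R (with_topology tau') /\
    (closed (Y1 : set (with_topology taup)) /\
     closed (Y2 : set (with_topology taup)) /\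
     topological_direct_sum taup Y1 Y2) /\
    tvs_isomorphic taup Y1 Y2 /\
    (same_on taup tau' Y1 /\ same_on taup tau' Y2) /\
    (exists D : set (@subspace_type (with_topology taup) Y1),
      [/\ closed D, isolated D = D, ~ countable D &
          forall y, D y -> even_functions012 (val y)]) /\
    prod_sigma_algebra (borel_sets (X := with_topology tau'))
                       (borel_sets (X := with_topology tau')) <>
      borel_sets (X := (with_topology tau' * with_topology tau')%type) /\
    (exists2 P : with_topology tau' -> @subspace_type (with_topology tau') Y1,
      forall g : X, Y2 (g - val (P g)) & ~ borel_fun P) /\
    ~ submod_closed (mem [set H : E -> X |
        borel_fun (H : E -> with_topology tau')]).
Proof.
have H : separable_ordered_group ord by split.
have Hmu : haar_measure mu by [].
move=> X taup.
exists (@tau' R E d ord mu), (@even_part R E d ord H mu Hmu), (@odd_part R E d ord H mu Hmu).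
split; first exact: hausdorff_tau'.
split; first exact: even_cstar.
split; first exact: odd_banach.
split; first exact: finer_tau_p.
split; first exact: not_universally_measurable.
split; first by split; [exact: closed_even|split; [exact: closed_odd|exact: direct_sum]].
split; first exact: even_odd_isomorphic.
split; first by split; [exact: same_even|exact: same_odd].
split; first exact: even_discrete_set.
split; first exact: product_borel_neq.
split; first exact: projection_not_borel.
exact: borel_maps_not_linear.
Qed.
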